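(* Almost everywhere, $\lim_{n\to\infty}\frac{\mathsf a'_n}{\sum_{k=1}^{n-1}\mathsf a_k}=0$. More generally, let $g:[0,\infty)\to(3,\infty)$ be measurable with the property that $g(\eta(t))\asymp g(t)$ whenever $\eta(t)\sim t$ as $t\to\infty$. Then for some (any sufficiently large) $c>1$, \[ \limsup_{n\to\infty}\frac{g(\mathsf a'_n)}{\sum_{k=1}^{n-1}\mathsf a_k}=\infty\ \text{a.e.}\quad\Longleftrightarrow\quad\int_c^\infty\frac{g(y)}{\log g(y)}\frac{dy}{y^2\log y}=\infty, \] while if the integral is finite, $\lim_{n\to\infty}\frac{g(\mathsf a'_n)}{\sum_{k=1}^{n-1}\mathsf a_k}=0$ a.e.
   Context: $I=(0,1]$, ''a.e.'' refers to Lebesgue measure on $I$, $\mathsf a_n(x)$ denotes the $n$-th continued fraction digit of $x\in I$. $\mathbb P$ is the set of primes. The prime digits are $\mathsf a'_n(x):=\mathsf a_n(x)$ if $\mathsf a_n(x)\in\mathbb P$ and $\mathsf a'_n(x):=0$ otherwise. $g(t)\sim h(t)$ means $g(t)/h(t)\to1$; $g(t)\asymp h(t)$ means $0<\liminf_{t\to\infty}g(t)/h(t)\le\limsup_{t\to\infty}g(t)/h(t)<\infty$. *)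

(* Defs.v *)
From HB Require Import structures.
From mathcomp Require Import all_boot all_order all_algebra.
From mathcomp Require Import all_classical all_reals all_analysis.
Set Implicit Arguments. Unset Strict Implicit. Unset Printing Implicit Defensive.
Import Order.TTheory GRing.Theory Num.Theory.
Import numFieldNormedType.Exports.
Local Open Scope classical_set_scope.
Local Open Scope ring_scope.

Section CF.
Variable R : realType.

Definition gauss_map (x : R) : R :=
  if x == 0 then 0 else x^-1 - (Num.floor (x^-1))%:~R.

(* n-th continued fraction digit (n >= 1) of x in (0,1]:
   a_n(x) = floor(1 / T^(n-1)(x)); set to 0 once the expansion has
   terminated (T^(n-1) x = 0, only for rational x, a null set). *)
Definition cf_digit (n : nat) (x : R) : nat :=
  let y := iter n.-1 gauss_map x in
  if y == 0 then 0%N else Num.truncn (y^-1).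

Definition cf_prime_digit (n : nat) (x : R) : nat :=
  if prime (cf_digit n x) then cf_digit n x else 0%N.

Definition cf_partial_sum (n : nat) (x : R) : R :=
  (\sum_(1 <= k < n) cf_digit k x)%:R.

Definition asymp (g h : R -> R) : Prop :=
  let r := fun t => ((g t / h t)%:E : \bar R) in
  [/\ (0 < limf_einf r (pinfty_nbhs R))%E,
      (limf_einf r (pinfty_nbhs R) <= limf_esup r (pinfty_nbhs R))%E &
      (limf_esup r (pinfty_nbhs R) < +oo)%E].

Definition equiv_at_infty (g h : R -> R) : Prop :=
  (fun t => g t / h t) @ pinfty_nbhs R --> (1 : R).

End CF.

(* Main.v *)
(** Given the first n digits, the next digit of a Lebesgue-random point equals k
    with conditional probability between 1/(3 k^2) and 2/k^2, because the cylinder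
    of a word has length 1/(q (q + q')), q and q' being its last two convergent
    denominators.  Everything probabilistic uses only these two bounds.

    Let S n be the sum of the first n digits.  A Laplace transform estimate gives
    S n >= n ln n / 48 eventually, almost surely; truncating the digits at D n
    gives S n <= C n ln n with probability close to 1 for each large n.  The event
    f (a_n) > K n ln n has probability comparable to the sum of 1/k^2 over the k
    with f k > K n ln n, and summing over n yields the series
    sum_k h (f k) / k^2 with h X = X / ln X.  If it converges, the Borel-Cantelli
    lemma and the lower bound on S n give the limit 0.  If it diverges, a
    conditional Borel-Cantelli argument applied to the events
    f (a_n) > K n ln n and S n <= C n ln n gives an unbounded ratio.

    Finally take f k = g k for prime k and f k = g 0 otherwise.  The condition on g
    forces g s and g t to be comparable for large t <= s <= 4 t, so on each block
    [4^j, 4^(j+1)) the integral and the sum over primes are both comparable to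
    h (g (4^j)) / (j 4^j), by Chebyshev's bounds for the number of primes. *)
Require Import Defs.
From HB Require Import structures.
From mathcomp Require Import all_boot all_order all_algebra.
From mathcomp Require Import all_classical all_reals all_analysis.
From mathcomp Require Import measurable_realfun.
From mathcomp Require Import ring lra zify.
Set Implicit Arguments. Unset Strict Implicit. Unset Printing Implicit Defensive.
Import Order.TTheory GRing.Theory Num.Theory.
Import numFieldNormedType.Exports.
Local Open Scope classical_set_scope.
Local Open Scope ring_scope.

(** * Primes between consecutive powers of 4 *)

Section Chebyshev.
Local Open Scope nat_scope.

Lemma bin_le_exp2 n k : 'C(n, k) <= 2 ^ n.
Proof.
have [lkn|nk] := leqP k n; last by rewrite bin_small.
have -> : 2 ^ n = (1 + 1) ^ n by []. rewrite expnDn (bigD1 (Ordinal (lkn : k < n.+1)))//=.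
by rewrite !exp1n !muln1 leq_addr.
Qed.

(** Induction: the ratio of consecutive central coefficients is [2 (2 n + 1) / (n + 1)], so the
    right-hand side grows at least by the factor 4. *)
Lemma exp4_le_central_bin n : 0 < n -> 4 ^ n <= 2 * n * 'C(2 * n, n).
Proof.
case: n => // n _; elim: n => // n IH.
have E : n.+2 * 'C(2 * n.+2, n.+2) = 2 * (2 * n.+1).+1 * 'C(2 * n.+1, n.+1).
  have h1 := mul_bin_diag (2 * n.+2) n.+1.
  have h2 := mul_bin_diag (2 * n.+2).-1 n.+1.
  have h3 : 'C((2 * n.+2).-1, n.+1) = 'C((2 * n.+2).-1, n.+2).
    rewrite -bin_sub; last lia.
    by congr 'C(_, _); lia.
  have e1 : (2 * n.+2).-1.-1 = 2 * n.+1 by lia.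
  have e2 : (2 * n.+2).-1 = (2 * n.+1).+1 by lia.
  rewrite e1 e2 in h1 h2 h3 *.
  nia.
rewrite expnS; nia.
Qed.

(** Doubling: every prime between [2 ^ j] and [2 ^ j.+1] divides the central coefficient
    ['C(2 ^ j.+1, 2 ^ j)], hence so does their product, and that coefficient is at most
    [4 ^ (2 ^ j)]. *)
Lemma primorial_pow2 j : \prod_(0 <= p < (2 ^ j).+1 | prime p) p <= 4 ^ (2 ^ j).
Proof.
elim: j => [|j IH]; first by rewrite unlock.
have l1 : (2 ^ j).+1 <= (2 ^ j.+1).+1 by rewrite ltnS leq_exp2l.
rewrite (big_cat_nat (n := (2 ^ j).+1))//=.
have -> : 4 ^ 2 ^ j.+1 = 4 ^ 2 ^ j * 4 ^ 2 ^ j by rewrite expnS mul2n -addnn expnD.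
rewrite leq_mul//.
rewrite -[4]/(2 ^ 2) -expnM -expnS.
apply: leq_trans (bin_le_exp2 (2 ^ j.+1) (2 ^ j)).
apply: dvdn_leq; first by rewrite bin_gt0 leq_exp2l.
set N := 'C(_, _).
have : forall m, \prod_((2 ^ j).+1 <= p < m | prime p && (p <= 2 ^ j.+1)) p %| N.
  elim=> [|m IHm]; first by rewrite big_geq.
  have [lm|gm] := leqP (2 ^ j).+1 m; last by rewrite big_geq.
  rewrite big_mkcond big_nat_recr//= -big_mkcond /=.
  case: ifP => [/andP[pm lm2]|_]; last by rewrite muln1.
  rewrite Gauss_dvd ?IHm /=; last first.
    rewrite coprime_sym big_nat_cond.
    elim/big_rec: _ => [|p x /andP[/andP[lp pm']/andP[pp _]] cx]; first exact: coprimen1.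
    rewrite coprimeMr cx andbT prime_coprime// dvdn_prime2//; apply/eqP; lia.
  have : m %| 'C(2 ^ j.+1, 2 ^ j) * ((2 ^ j)`! * (2 ^ j.+1 - 2 ^ j)`!).
    by rewrite bin_fact ?leq_exp2l// dvdn_fact// prime_gt0.
  rewrite Euclid_dvdM// => /orP[//|].
  have -> : 2 ^ j.+1 - 2 ^ j = 2 ^ j by rewrite expnS; lia.
  rewrite Euclid_dvdM// orbb.
  have nf : forall k, k < m -> (m %| k`!) = false.
    elim=> [|k IHk] lk; first by rewrite fact0 dvdn1; apply/eqP => e; rewrite e in pm.
    rewrite factS Euclid_dvdM// IHk ?orbF; last lia.
    by apply/negP => /dvdn_leq -/(_ isT); lia.
  by rewrite nf.
move/(_ (2 ^ j.+1).+1); rewrite big_nat_cond [in X in _ -> X]big_nat_cond.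
rewrite (eq_bigl (fun i => ((2 ^ j).+1 <= i < (2 ^ j.+1).+1) && prime i))// => i.
by rewrite ltnS; case: (i <= _); rewrite ?andbT ?andbF.
Qed.

(** Legendre's formula: each power [p ^ k] adds to the exponent the floor of [2 n / p ^ k] minus
    twice that of [n / p ^ k], which is 0 or 1, and 0 once [p ^ k] exceeds [2 n]. *)
Lemma pfactor_central_bin p n : prime p -> 0 < n -> p ^ logn p 'C(2 * n, n) <= 2 * n.
Proof.
move=> pp n0; have p1 := prime_gt1 pp; have p0 := prime_gt0 pp.
set t := trunc_log p (2 * n).
suff lt : logn p 'C(2 * n, n) <= t.
  by apply: leq_trans (trunc_logP p1 _); rewrite ?leq_exp2l//; lia.
have nn : 2 * n - n = n by lia.
have := @bin_fact (2 * n) n ltac:(lia); rewrite nn => /(congr1 (logn p)).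
rewrite !lognM ?muln_gt0 ?fact_gt0 ?bin_gt0//; last lia.
rewrite !logn_fact//.
(* The sum for the factorial of [n] is padded with zero terms, so that both sums can be compared
   term by term. *)
have -> : \sum_(1 <= k < n.+1) n %/ p ^ k = \sum_(1 <= k < (2 * n).+1) n %/ p ^ k.
  rewrite [RHS](big_cat_nat (n := n.+1))//=; last lia.
  rewrite [X in _ = _ + X]big1_seq ?addn0// => k /andP[_].
  rewrite mem_index_iota => /andP[lk _]; apply: divn_small.
  by apply: leq_trans (ltn_expl k p1); lia.
rewrite -big_split/=.
have : \sum_(1 <= k < (2 * n).+1) (2 * n) %/ p ^ k <=
    \sum_(1 <= k < (2 * n).+1) (n %/ p ^ k + n %/ p ^ k) + \sum_(1 <= k < (2 * n).+1) (k <= t).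
  rewrite -big_split/=; apply: leq_sum => k _.
  have [kt|tk] := leqP k t.
    by rewrite mul2n -addnn divnD ?expn_gt0 ?p0// leq_add2l leq_b1.
  rewrite divn_small//; apply: leq_trans (trunc_log_ltn (2 * n) p1) _.
  by rewrite leq_exp2l.
have : \sum_(1 <= k < (2 * n).+1) (k <= t) <= t.
  elim: (2 * n) => [|m IH]; first by rewrite big_geq.
  suff : \sum_(1 <= k < m.+2) (k <= t) <= minn m.+1 t by lia.
  elim: m.+1 => [|k IHk]; first by rewrite big_geq.
  by rewrite big_nat_recr//=; case: leqP; lia.
lia.
Qed.

Lemma central_bin_prod n : 0 < n ->
  'C(2 * n, n) = \prod_(0 <= p < (2 * n).+1 | prime p) p ^ logn p 'C(2 * n, n).
Proof.
move=> n0; set N := 'C(2 * n, n).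
have N0 : 0 < N by rewrite bin_gt0; lia.
rewrite -{1}(partnT N0) (widen_partn _ (leq_maxl N (2 * n))).
rewrite (big_cat_nat (n := (2 * n).+1))//=; last by rewrite ltnS leq_maxr.
rewrite [X in _ * X]big1_seq ?muln1; last first.
  move=> p /andP[_]; rewrite mem_index_iota => /andP[lp _].
  case pp : (prime p); last by rewrite lognE pp.
  have := pfactor_central_bin pp n0; rewrite -/N; case: (logn p N) => // k.
  have := @leq_pexp2l p 1 k.+1 (prime_gt0 pp) isT; lia.
by rewrite [RHS]big_mkcond; apply: eq_bigr => p _; case: ifPn => // np; rewrite lognE (negbTE np).
Qed.

Lemma leq_prod_nat (P : pred nat) (F G : nat -> nat) m n :
  (forall i, m <= i < n -> P i -> F i <= G i) ->
  \prod_(m <= i < n | P i) F i <= \prod_(m <= i < n | P i) G i.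
Proof.
move=> FG; rewrite big_nat_cond [leqRHS]big_nat_cond.
by apply: leq_prod => i /andP[mi Pi]; exact: FG.
Qed.

Lemma prod_const_le (P : pred nat) c m n : 0 < c ->
  \prod_(m <= i < n | P i) c <= c ^ (n - m).
Proof.
move=> c0; rewrite big_const_seq.
have -> k : iter k (muln c) 1 = c ^ k by elim: k => //= k ->; rewrite expnS.
by rewrite leq_pexp2l// (leq_trans (count_size _ _))// size_iota.
Qed.

(** The primes are cut at [2 ^ j.+1], the square root of [4 ^ j.+1], and at [4 ^ j]. Below the first
    cut each prime power is at most [4 ^ j.+1]; above it the exponent is at most 1, and the primes
    up to [4 ^ j] are absorbed by the primorial bound. *)
Lemma central_bin_le j : 0 < j ->
  'C(4 ^ j.+1, 2 * 4 ^ j) <= (4 ^ j.+1) ^ (2 ^ j.+1).+1 *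
     (4 ^ (4 ^ j) * \prod_((4 ^ j).+1 <= p < (4 ^ j.+1).+1 | prime p) p).
Proof.
move=> j0; have E : 4 ^ j.+1 = 2 * (2 * 4 ^ j) by rewrite expnS mulnA.
have n0 : 0 < 2 * 4 ^ j by rewrite muln_gt0 expn_gt0.
rewrite {1}E (central_bin_prod n0) -E.
have sq : (2 ^ j.+1) ^ 2 = 4 ^ j.+1 by rewrite -expnM mulnC expnM.
have s4 : (2 ^ j.+1) <= 4 ^ j.
  by rewrite -[4]/(2 ^ 2) -expnM leq_exp2l//; lia.
rewrite (big_cat_nat (n := (2 ^ j.+1).+1))//=; last by rewrite ltnS; lia.
apply: leq_mul.
  apply: leq_trans (_ : \prod_(0 <= i < (2 ^ j.+1).+1 | prime i) 4 ^ j.+1 <= _).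
    by apply: leq_prod_nat => p _ pp; rewrite {2}E E; exact: pfactor_central_bin.
  by apply: leq_trans (prod_const_le _ _ _ _) _; rewrite ?expn_gt0 ?subn0.
apply: leq_trans (_ : \prod_((2 ^ j.+1).+1 <= i < (4 ^ j.+1).+1 | prime i) i <= _).
  apply: leq_prod_nat => p /andP[lp _] pp.
  have := pfactor_central_bin pp n0; rewrite -E.
  case: (logn p _) => [|[|k]]; rewrite ?expn0 ?(prime_gt0 pp)//.
  move=> h; suff : p ^ 2 <= 4 ^ j.+1 by rewrite -sq leq_exp2r; lia.
  by apply: leq_trans h; rewrite leq_pexp2l ?(prime_gt0 pp).
rewrite (big_cat_nat (n := (4 ^ j).+1))//=; last by rewrite ltnS leq_exp2l.
rewrite leq_mul2r; apply/orP; right.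
have := primorial_pow2 (2 * j); rewrite expnM; apply: leq_trans.
rewrite [leqRHS](big_cat_nat (n := (2 ^ j.+1).+1))//= leq_pmull//.
by apply: prodn_cond_gt0 => p /prime_gt0.
Qed.

Definition prime_block j := count prime (index_iota (4 ^ j) (4 ^ j.+1)).

Lemma prod_count (P : pred nat) c m n :
  \prod_(m <= i < n | P i) c = c ^ count P (index_iota m n).
Proof. by rewrite big_const_seq; elim: (count _ _) => //= k ->; rewrite expnS. Qed.

Lemma pow4_not_prime j : prime (4 ^ j.+1) = false.
Proof.
apply: negbTE; apply/primePn; right; exists 2; last by rewrite dvdn_exp.
by have := expn_gt0 4 j; rewrite expnS; lia.
Qed.

(** Each prime of the block is at least [4 ^ j], while their product is at most the primorial of
    [4 ^ j.+1]; the claim compares exponents of 4. *)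
Lemma prime_block_le j : j * prime_block j <= 4 ^ j.+1.
Proof.
rewrite -(@leq_exp2l 4)// expnM -prod_count.
apply: leq_trans (_ : \prod_(4 ^ j <= i < 4 ^ j.+1 | prime i) i <= _).
  by apply: leq_prod_nat => i /andP[].
have := primorial_pow2 (2 * j.+1); rewrite expnM; apply: leq_trans.
rewrite -[2 ^ 2]/4 [leqRHS](big_cat_nat (n := 4 ^ j))//=; last first.
  by rewrite ltnW// ltnS leq_exp2l.
rewrite [X in _ <= _ * X](big_cat_nat (n := 4 ^ j.+1))//=; last by rewrite leq_exp2l.
have P0 : forall a b, 0 < \prod_(a <= i < b | prime i) i.
  by move=> a b; apply: prodn_cond_gt0 => p /prime_gt0.
by rewrite mulnCA leq_pmulr// muln_gt0 !P0.
Qed.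

(** Here too exponents of 4 are compared, in the two bounds for the central coefficient; each prime
    of the block counts for at most [j.+1]. *)
Lemma prime_block_ge j : 5 <= j -> 4 ^ j <= 2 * j.+1 * prime_block j.
Proof.
move=> j5; have j0 : 0 < j by lia.
have n0 : 0 < 2 * 4 ^ j by rewrite muln_gt0 expn_gt0.
have := exp4_le_central_bin n0.
have E : 4 ^ j.+1 = 2 * (2 * 4 ^ j) by rewrite expnS mulnA.
have := central_bin_le j0; rewrite -E.
have -> : \prod_((4 ^ j).+1 <= p < (4 ^ j.+1).+1 | prime p) p = \prod_(4 ^ j <= p < 4 ^ j.+1 | prime p) p.
  rewrite [LHS]big_mkcond [RHS]big_mkcond big_nat_recr ?ltn_exp2l//= pow4_not_prime muln1.
  rewrite [RHS]big_ltn ?ltn_exp2l//; case: j {j5 n0 E} j0 => // j _.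
  by rewrite pow4_not_prime/= mul1n.
have : \prod_(4 ^ j <= i < 4 ^ j.+1 | prime i) i <= 4 ^ (j.+1 * prime_block j).
  rewrite expnM -prod_count; apply: leq_prod_nat => i /andP[_ h] _; exact: ltnW.
move=> h1 h2 h3.
have : 4 ^ (2 * 4 ^ j) <= 4 ^ (j.+1 + (j.+1 * (2 ^ j.+1).+1 + (4 ^ j + j.+1 * prime_block j))).
  apply: leq_trans h3 _; rewrite expnD; apply: leq_mul => //; rewrite expnD.
  apply: leq_trans h2 _; apply: leq_mul; first by rewrite -expnM.
  by rewrite expnD; apply: leq_mul.
rewrite leq_exp2l// => h4.
(* The error terms take up at most half of [4 ^ j]; the condition [5 <= j] serves this
   inequality. *)
have : 2 * (j.+1 * (2 ^ j.+1).+2) <= 4 ^ j.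
  clear -j5; have -> : 4 ^ j = 2 ^ j * 2 ^ j by rewrite -expnMn.
  rewrite expnS.
  have : 5 * j.+1 <= 2 ^ j - 2.
    elim: j j5 => // j IH; rewrite leq_eqVlt => /predU1P[<-//|/IH]; rewrite expnS; lia.
  have : 5 <= j by [].
  nia.
nia.
Qed.

End Chebyshev.

(** * Elementary series and logarithms *)

Section RealLemmas.
Variable R : realType.
Implicit Types (x y : R) (m n k : nat).

Lemma nneseries_le_bound (u : nat -> \bar R) (M : \bar R) :
  (forall k, 0 <= u k)%E -> (forall n, \sum_(0 <= k < n) u k <= M)%E ->
  (\sum_(k <oo) u k <= M)%E.
Proof.
move=> u0 uM; apply: lime_le; first by apply: is_cvg_nneseries => *; exact: u0.
by apply: nearW => n; exact: uM.
Qed.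

Lemma sum_le_nneseries (u : nat -> \bar R) n :
  (forall k, 0 <= u k)%E -> (\sum_(0 <= k < n) u k <= \sum_(k <oo) u k)%E.
Proof. by move=> u0; apply: nneseries_lim_ge => *; exact: u0. Qed.

Definition sqinv k : R := (k%:R ^+ 2)^-1.

Lemma sqinv_ge0 k : 0 <= sqinv k.
Proof. by rewrite invr_ge0 exprn_ge0. Qed.

Lemma sqinv0 : sqinv 0 = 0.
Proof. by rewrite /sqinv expr0n invr0. Qed.

Lemma sqinv_telescope k : (0 < k)%N -> sqinv k.+1 <= k%:R^-1 - k.+1%:R^-1.
Proof.
move=> k0; have k1 : 1 <= k%:R :> R by rewrite ler1n.
rewrite /sqinv -natr1 [leRHS](_ : _ = (k%:R * (k%:R + 1))^-1); last first.
  by field; rewrite !gt_eqF; lra.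
by rewrite lef_pV2 ?posrE ?mulr_gt0 ?exprn_gt0; nra.
Qed.

Lemma sum_sqinv_tail m n : (0 < m)%N -> \sum_(m.+1 <= k < n) sqinv k <= m%:R^-1.
Proof.
move=> m0; suff : forall j, \sum_(m.+1 <= k < (m + j).+1) sqinv k <= m%:R^-1 - (m + j)%:R^-1.
  move=> h; have [nm|mn] := leqP n m.+1; first by rewrite big_geq// invr_ge0.
  have := h (n.-1 - m)%N; rewrite subnKC; last by lia.
  rewrite prednK; last by lia.
  by move/le_trans; apply; rewrite gerBl invr_ge0.
elim=> [|j IH]; first by rewrite !addn0 big_geq// subrr.
rewrite addnS big_nat_recr/=; last by rewrite ltnS leq_addr.
by rewrite (le_trans (lerD IH (sqinv_telescope _)))// ?addrA ?subrK//; lia.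
Qed.

Lemma sum_sqinv_le2 n : \sum_(0 <= k < n) sqinv k <= 2.
Proof.
case: n => [|[|n]]; first by rewrite big_geq//.
  by rewrite big_nat1 sqinv0.
rewrite big_ltn// big_ltn// sqinv0 add0r.
have := @sum_sqinv_tail 1 n.+2 isT.
have s1 : sqinv 1 = 1 by rewrite /sqinv expr1n invr1.
by rewrite s1 invr1; lra.
Qed.

(** Both bounds are [ln (1 + t) <= t], at [t = 1 / k] and at [t = - 1 / (k + 1)]. *)
Lemma ln_ratio k : (0 < k)%N -> k.+1%:R^-1 <= ln k.+1%:R - ln (k%:R : R) <= k%:R^-1.
Proof.
move=> k0; have k1 : 1 <= k%:R :> R by rewrite ler1n.
have e1 : ln k.+1%:R = ln k%:R + ln (1 + k%:R^-1) :> R.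
  rewrite -lnM ?posrE; first by congr ln; rewrite -natr1; field; rewrite gt_eqF; lra.
    by lra.
  by rewrite ltr_pwDl// invr_ge0; lra.
have e2 : ln k%:R = ln k.+1%:R + ln (1 - k.+1%:R^-1) :> R.
  have k2 : k.+1%:R^-1 < 1 :> R by rewrite invf_lt1// ltr1n.
  rewrite -lnM ?posrE//; last by rewrite subr_gt0.
  by congr ln; rewrite -natr1; field; rewrite gt_eqF; lra.
have h1 : ln (1 + k%:R^-1) <= k%:R^-1 :> R.
  by apply: le_ln1Dx; apply: (@lt_le_trans _ _ 0); rewrite ?ltrN10// invr_ge0.
have h2 : ln (1 - k.+1%:R^-1) <= - k.+1%:R^-1 :> R.
  by apply: le_ln1Dx; rewrite ltrN2 invf_lt1// ltr1n.
by move: e1 e2 h1 h2; move: (k.+1%:R^-1) => u; move: (ln (1 - u)) (ln (1 + _)) (k%:R^-1) (ln k%:R) (ln _) => *; lra.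
Qed.

Lemma ln_harmonic_le n : ln n%:R <= \sum_(1 <= k < n.+1) k%:R^-1 :> R.
Proof.
case: n => [|n]; first by rewrite ln0// big_geq.
apply: (@le_trans _ _ (ln n.+2%:R)).
  by rewrite ler_ln ?posrE// ler_nat.
elim: n.+1 => [|k IH]; first by rewrite ln1 big_geq.
rewrite big_nat_recr//=.
have /andP[_] := @ln_ratio k.+1 isT; rewrite lerBlDl => /le_trans; apply.
by rewrite lerD2r.
Qed.

Lemma harmonic_le_ln n : (0 < n)%N -> \sum_(1 <= k < n.+1) k%:R^-1 <= 1 + ln n%:R :> R.
Proof.
case: n => // n _; elim: n => [|n IH]; first by rewrite big_nat1 ln1 invr1 addr0.
rewrite big_nat_recr//=.
have /andP[+ _] := @ln_ratio n.+1 isT; rewrite lerBrDl => h.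
by apply: le_trans (lerD IH (lexx _)) _; rewrite -addrA lerD2l.
Qed.

Lemma expRN_le x : 0 <= x <= 1 -> expR (- x) <= 1 - x / 2.
Proof.
move=> /andP[x0 x1]; have := expR_ge1Dx x; rewrite expRN => h.
apply: (@le_trans _ _ (1 + x)^-1); first by rewrite lef_pV2 ?posrE ?expR_gt0//; lra.
by rewrite -[leLHS]mul1r ler_pdivrMr; nra.
Qed.

End RealLemmas.
Arguments sqinv {R} k.

(** * Continued fraction cylinders *)

Section Measurability.
Variable R : realType.

Lemma measurable_invr : measurable_fun [set: R] (fun x : R => x^-1).
Proof.
rewrite -(setUv [set 0 : R]); apply/measurable_funU => //; first exact: measurableC.
split; first exact: measurable_fun_set1.
apply: open_continuous_measurable_fun; first by apply: closed_openC.
by move=> x; rewrite inE => /eqP x0; exact: inv_continuous.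
Qed.

Lemma measurable_floorr : measurable_fun [set: R] (fun x : R => (Num.floor x)%:~R : R).
Proof.
apply: nondecreasing_measurable => // x y xy.
by rewrite ler_int le_floor.
Qed.

Lemma measurable_gauss_map : measurable_fun [set: R] (@gauss_map R).
Proof.
rewrite /gauss_map; apply: measurable_fun_ifT => //.
  by apply: measurable_fun_eqr.
apply: measurable_funB; first exact: measurable_invr.
by apply: (measurableT_comp measurable_floorr); exact: measurable_invr.
Qed.

Lemma measurable_cf_digit n : measurable_fun [set: R] (@cf_digit R n : R -> nat).
Proof.
have mT m : measurable_fun [set: R] (iter m (@gauss_map R)).
  elim: m => [|m IH]; first exact: measurable_id.
  exact: (measurableT_comp measurable_gauss_map).
pose f (x : R) : R := (cf_digit n x)%:R.
have mf : measurable_fun [set: R] f.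
  rewrite /f /cf_digit; pose y (x : R) := iter n.-1 (@gauss_map R) x.
  have -> : (fun x => (if y x == 0 then 0%N else Num.truncn (y x)^-1)%:R : R) =
     (fun x => if y x == 0 then 0 else (Num.truncn (y x)^-1)%:R).
    by apply/funext => x; case: ifP.
  apply: measurable_fun_ifT => //; first by apply: measurable_fun_eqr => //; exact: mT.
  have mt : measurable_fun [set: R] (fun x : R => (Num.truncn x)%:R : R).
    by apply: nondecreasing_measurable => // u v uv; rewrite ler_nat le_truncn.
  apply: (measurableT_comp mt); apply: (measurableT_comp measurable_invr); exact: mT.
move=> _ Y _; rewrite setTI.
(* Any set of digits becomes a countable, hence measurable, set of reals, so measurability of the
   real-valued [f] suffices. *)
have -> : cf_digit n @^-1` Y = f @^-1` ((fun k : nat => k%:R) @` Y).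
  apply/seteqP; split => x /=; first by move=> Yx; exists (cf_digit n x).
  by move=> [k Yk /eqP]; rewrite eqr_nat => /eqP <-.
rewrite -[X in measurable X]setTI; apply: mf => //.
rewrite (_ : _ @` _ = \bigcup_(k in Y) [set k%:R]).
  by apply: bigcup_measurable => k _; exact: measurable_set1.
by apply/seteqP; split=> z [k Yk e]; exists k => //=.
Qed.

End Measurability.

Section Cylinders.
Variable R : realType.
Implicit Types (w : seq nat) (x y : R) (k n : nat).

(** The pairs hold [(p_n, p_(n-1))] and [(q_n, q_(n-1))], the last two convergent numerators and
    denominators; the initial pairs are those of indices 0 and -1. *)
Definition cf_step (c : R * R) k : R * R := (k%:R * c.1 + c.2, c.1).
Definition cf_num w : R * R := foldl cf_step (0, 1) w.
Definition cf_den w : R * R := foldl cf_step (1, 0) w.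

(* The point [0; w_1, ..., w_n + y]. *)
Definition cf_point w y : R :=
  ((cf_num w).1 + y * (cf_num w).2) / ((cf_den w).1 + y * (cf_den w).2).

Definition cf_word n x : seq nat := mkseq (fun j => cf_digit j.+1 x) n.
Arguments cf_word : simpl never.

Lemma cf_num_rcons w k : cf_num (rcons w k) = cf_step (cf_num w) k.
Proof. by rewrite /cf_num foldl_rcons. Qed.

Lemma cf_den_rcons w k : cf_den (rcons w k) = cf_step (cf_den w) k.
Proof. by rewrite /cf_den foldl_rcons. Qed.

Lemma cf_den_bounds w : all (leq 1) w ->
  [/\ 0 < (cf_den w).1, 0 <= (cf_den w).2 & (cf_den w).2 <= (cf_den w).1].
Proof.
elim/last_ind: w => [_|w k IH]; first by rewrite /cf_den /=; split.
rewrite all_rcons => /andP[k1 /IH[d0 d0' dd]]; rewrite cf_den_rcons /=.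
have k1R : 1 <= k%:R :> R by rewrite ler1n.
by split; nra.
Qed.

(** The determinant is 1 or -1 according to the parity of the length; squaring it removes the
    sign. *)
Lemma cf_det w :
  ((cf_num w).1 * (cf_den w).2 - (cf_num w).2 * (cf_den w).1) ^+ 2 = 1.
Proof.
elim/last_ind: w => [|w k IH]; first by rewrite /cf_num /cf_den /=; ring.
by rewrite cf_num_rcons cf_den_rcons /= -[RHS]IH; ring.
Qed.

Lemma cf_den_gt0 w y : all (leq 1) w -> 0 <= y ->
  0 < (cf_den w).1 + y * (cf_den w).2.
Proof. by move=> /cf_den_bounds[? ? ?] y0; rewrite ltr_pwDl// mulr_ge0. Qed.

Lemma cf_point_rcons w k y : all (leq 1) w -> (0 < k)%N -> 0 <= y ->
  cf_point (rcons w k) y = cf_point w (k%:R + y)^-1.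
Proof.
move=> wP k0 y0; have k1R : 1 <= k%:R :> R by rewrite ler1n.
have ky0 : k%:R + y != 0 by rewrite gt_eqF// ltr_pwDl// (lt_le_trans _ k1R).
have d1 : (cf_den w).1 + (k%:R + y)^-1 * (cf_den w).2 != 0.
  by rewrite gt_eqF// cf_den_gt0// invr_ge0; lra.
have d2 : (k%:R + y) * (cf_den w).1 + (cf_den w).2 != 0.
  by case: (cf_den_bounds wP) => ? ? ?; rewrite gt_eqF//; nra.
rewrite /cf_point cf_num_rcons cf_den_rcons /=.
field.
by rewrite ky0 /= mulrC.
Qed.

Lemma gauss_map_ge0 x : 0 <= gauss_map x < 1.
Proof.
rewrite /gauss_map; case: ifP => _; first by rewrite lexx ltr01.
have /andP[h1 h2] := floor_itv x^-1.
by move: h2; rewrite intrD mulr1z; lra.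
Qed.

Lemma gauss_map_inv y : 0 < y -> y = ((Num.truncn y^-1)%:R + gauss_map y)^-1.
Proof.
move=> y0; rewrite /gauss_map gt_eqF//.
by rewrite truncn_floor invr_ge0 ltW// natr_absz ger0_norm ?floor_ge0 ?invr_ge0 ?ltW// addrC subrK invrK.
Qed.

Lemma cf_wordS n x : cf_word n.+1 x = rcons (cf_word n x) (cf_digit n.+1 x).
Proof. by rewrite /cf_word mkseqS. Qed.

(** Inverts the expansion: [x] is the Möbius image of its [n]-th Gauss iterate. The iterate 1 is
    allowed because of [n = 0], [x = 1]. *)
Lemma cf_word_point n x w : 0 < x <= 1 -> cf_word n x = w -> all (leq 1) w ->
  x = cf_point w (iter n (@gauss_map R) x) /\ 0 <= iter n (@gauss_map R) x <= 1.
Proof.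
move=> x01; elim: n w => [|n IH] w <-.
  rewrite /cf_word /= => _; split; last by case/andP: x01 => /ltW -> ->.
  by rewrite /cf_point /cf_num /cf_den /=; field.
rewrite cf_wordS all_rcons => /andP[dn wn].
have [xE /andP[xn _]] := IH _ erefl wn; set y := iter n _ x in xE xn.
(* A vanishing iterate would give the digit 0, which the hypothesis on the word excludes. *)
have y0 : y != 0 by apply: contraTneq dn => y0; rewrite /cf_digit/= -/y y0 eqxx.
have y01 : 0 < y by rewrite lt_def y0.
have /andP[t0 /ltW t1] := gauss_map_ge0 y.
rewrite iterS -/y t0 t1; split => //.
rewrite cf_point_rcons//.
by rewrite {1}xE {1}(gauss_map_inv y01) /cf_digit /= -/y (negbTE y0).
Qed.

Lemma cf_point_word w y : all (leq 1) w -> 0 < y < 1 ->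
  [/\ 0 < cf_point w y < 1, iter (size w) (@gauss_map R) (cf_point w y) = y &
      cf_word (size w) (cf_point w y) = w].
Proof.
elim/last_ind: w y => [|w k IH] y.
  have -> : cf_point [::] y = y by rewrite /cf_point /cf_num /cf_den /=; field.
  by [].
rewrite all_rcons => /andP[k1 wP] /andP[y0 y1]; rewrite size_rcons.
have k1R : 1 <= k%:R :> R by rewrite ler1n.
rewrite cf_point_rcons ?ltW//; set z := (k%:R + y)^-1.
have zi : z^-1 = k%:R + y by rewrite /z invrK.
have z0 : 0 < z by rewrite invr_gt0; lra.
have z01 : 0 < z < 1 by rewrite z0 invf_lt1; lra.
have [x01 xn xw] := IH z wP z01.
have tz : Num.truncn z^-1 = k.
  by apply: truncn_def; rewrite zi -natr1; lra.
split => //.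
  rewrite iterS xn /gauss_map gt_eqF// zi.
  rewrite (_ : Num.floor _ = k%:Z); first by rewrite -pmulrn; ring.
  by apply: floor_def; rewrite intrD -!pmulrn mulr1n; lra.
by rewrite cf_wordS xw /cf_digit /= xn gt_eqF// tz.
Qed.

Definition cylinder n w : set R := `]0, 1] `&` [set x | cf_word n x = w].

Lemma measurable_cylinder n w : measurable (cylinder n w).
Proof.
apply: measurableI => //; elim: n w => [|n IH] w.
  rewrite /cf_word /=; have [<-|wn] := pselect ([::] = w).
    by rewrite (_ : [set _ | _] = setT)//; apply/seteqP; split.
  by rewrite (_ : [set _ | _] = set0)//; apply/seteqP; split.
case/lastP: w => [|w k].
  rewrite (_ : [set _ | _] = set0)//; apply/seteqP; split => // x /=.
rewrite (_ : [set _ | _] = [set x | cf_word n x = w] `&` (cf_digit n.+1 @^-1` [set k])).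
  apply: measurableI; first exact: IH.
  by rewrite -[X in measurable X]setTI; apply: measurable_cf_digit.
apply/seteqP; split => x /=; rewrite cf_wordS; last by move=> [-> ->].
by move/rcons_inj => [].
Qed.

(** Makes it unnecessary to decide which endpoints belong to a cylinder. *)
Lemma lebesgue_measure_between (E : set R) a b : a < b -> measurable E ->
  `]a, b[%classic `<=` E -> E `<=` `[a, b]%classic ->
  lebesgue_measure E = (b - a)%:E.
Proof.
move=> ab mE h1 h2; have itvE (b0 b1 : bool) :
    lebesgue_measure [set` Interval (BSide b0 a) (BSide b1 b)] = (b - a)%:E :> \bar R.
  by rewrite lebesgue_measure_itv/= lte_fin ab EFinB.
apply/eqP; rewrite eq_le; apply/andP; split.
  by rewrite -(itvE true false); apply: le_measure; rewrite ?inE.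
by rewrite -(itvE false true); apply: le_measure; rewrite ?inE.
Qed.

(** The cylinder is, up to endpoints, the image of the unit interval under [cf_point w], which runs
    from [u = p / q] to [v = (p + p') / (q + q')]. The determinant gives the distance of [u] and
    [v]. *)
Lemma measure_cylinder w : all (leq 1) w ->
  lebesgue_measure (cylinder (size w) w) =
  (((cf_den w).1 * ((cf_den w).1 + (cf_den w).2))^-1)%:E.
Proof.
move=> wP; have [q0 q0' qq] := cf_den_bounds wP.
have det := cf_det w.
pose E := cylinder (size w) w; have mE : measurable E := measurable_cylinder _ _.
set p := (cf_num w).1 in det *; set p' := (cf_num w).2 in det *.
set q := (cf_den w).1 in q0 qq det *; set q' := (cf_den w).2 in q0' qq det *.
pose u := p / q; pose v := (p + p') / (q + q').
have qq0 : 0 < q + q' by lra.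
(* The Möbius map is affine in the parameter [s = y (q + q') / (q + y q')], which itself sweeps the
   unit interval. *)
have mobE y : 0 <= y -> cf_point w y = u + (y * (q + q') / (q + y * q')) * (v - u).
  move=> y0; have := cf_den_gt0 wP y0; rewrite /cf_point -/p -/p' -/q -/q' /u /v => d0.
  by field; rewrite !gt_eqF.
have s01 y : 0 <= y <= 1 -> 0 <= y * (q + q') / (q + y * q') <= 1.
  move=> /andP[y0 y1]; have d0 := cf_den_gt0 wP y0; rewrite -/q -/q' in d0.
  rewrite divr_ge0 ?ler_pdivrMr ?mulr_ge0 ?mul1r ?(ltW d0) ?(ltW qq0)//=; nra.
have onto s : 0 < s < 1 -> exists2 y, 0 < y < 1 & y * (q + q') / (q + y * q') = s.
  move=> /andP[s0 s1]; have d0 : 0 < (q + q') - s * q' by nra.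
  exists (s * q / ((q + q') - s * q')).
    by rewrite divr_gt0 ?mulr_gt0// ltr_pdivrMr// mul1r; nra.
  have : 0 < q * (q + q') by nra.
  move=> e0; field; rewrite !gt_eqF//=.
  by rewrite [ltRHS](_ : _ = q * (q + q'))//; ring.
have vuE : (v - u) ^+ 2 = ((q * (q + q'))^-1) ^+ 2.
  rewrite -[RHS]mul1r -[X in _ = X * _]det /u /v; field.
  by rewrite !gt_eqF.
have L0 : 0 < (q * (q + q'))^-1 by rewrite invr_gt0 mulr_gt0.
have inE1 s : 0 < s < 1 -> E (u + s * (v - u)).
  move=> /onto[y y01 <-]; have [x01 xn xw] := cf_point_word wP y01.
  rewrite -mobE; last by case/andP: y01 => /ltW.
  by split => //=; rewrite in_itv/=; case/andP: x01 => -> /ltW.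
have inE2 x : E x -> exists2 s, 0 <= s <= 1 & x = u + s * (v - u).
  move=> [/=]; rewrite in_itv/= => x01 xw.
  have [xE y01] := cf_word_point x01 xw wP.
  have /andP[y0 _] := y01.
  by rewrite mobE// in xE; eexists; last exact: xE; exact: s01.
(* The parity of the length of [w] decides which of [u] and [v] is the left endpoint. *)
have [uv|vu] := leP u v.
  have vuE' : v - u = (q * (q + q'))^-1 by apply: (pexpIrn (n := 2)); rewrite ?nnegrE ?subr_ge0 ?(ltW L0).
  rewrite -vuE'; apply: lebesgue_measure_between => //; first by rewrite -subr_gt0 vuE'.
    move=> x /=; rewrite in_itv/= => /andP[ux xv].
    have -> : x = u + ((x - u) / (v - u)) * (v - u) by field; rewrite vuE' gt_eqF.
    apply: inE1; rewrite divr_gt0 ?ltr_pdivrMr ?mul1r; lra.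
  by move=> x /inE2[s /andP[s0 s1] ->]; rewrite /= in_itv/=; nra.
have uvE' : u - v = (q * (q + q'))^-1.
  by apply: (pexpIrn (n := 2)); rewrite ?nnegrE ?subr_ge0 ?(ltW L0) ?(ltW vu)// -sqrrN opprB.
rewrite -uvE'; apply: lebesgue_measure_between => //.
  move=> x /=; rewrite in_itv/= => /andP[ux xv].
  have -> : x = u + ((u - x) / (u - v)) * (v - u) by field; rewrite uvE' gt_eqF.
  apply: inE1; rewrite divr_gt0 ?ltr_pdivrMr ?mul1r; lra.
by move=> x /inE2[s /andP[s0 s1] ->]; rewrite /= in_itv/=; nra.
Qed.

Lemma cylinder_rcons n w k :
  cylinder n.+1 (rcons w k) = cylinder n w `&` (cf_digit n.+1 @^-1` [set k]).
Proof.
rewrite /cylinder -setIA; congr (_ `&` _).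
apply/seteqP; split => x /=; rewrite cf_wordS; first by move/rcons_inj => [].
by move=> [-> ->].
Qed.

(** A digit 0 after positive digits means that the Gauss iterate has reached 0, so that [x] is the
    single point [cf_point w 0]; longer words only shrink the set. *)
Lemma measure_cylinder0 w : ~~ all (leq 1) w ->
  lebesgue_measure (cylinder (size w) w) = 0%E.
Proof.
elim/last_ind: w => [//|w k IH]; rewrite all_rcons negb_and size_rcons => wk.
have mC := @measurable_cylinder.
have [wP|/IH w0] := boolP (all (leq 1) w); last first.
  by apply: (@subset_measure0 _ _ _ (@lebesgue_measure R) _ (cylinder (size w) w)); [exact: mC|exact: mC| |exact: w0]; rewrite cylinder_rcons; exact: subIsetl.
move: wk; rewrite wP orbF -eqn0Ngt => /eqP ->.
apply: (@subset_measure0 _ _ _ (@lebesgue_measure R) _ [set cf_point w 0]); [exact: mC|exact: measurable_set1| |exact: lebesgue_measure_set1].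
rewrite cylinder_rcons => x [[/=]]; rewrite in_itv/= => x01 xw d0.
have [xE /andP[y0' y1]] := cf_word_point x01 xw wP.
move: d0; rewrite /cf_digit/=; case: ifPn => [/eqP y0 _|y0 t0]; first by rewrite xE y0.
have : (0 < Num.truncn (iter (size w) (@gauss_map R) x)^-1)%N.
  have y00 : 0 < iter (size w) (@gauss_map R) x by rewrite lt_def y0.
  by rewrite truncn_gt0 invf_ge1.
by rewrite t0.
Qed.

(** For positive digits, appending [k] replaces [(q, q')] by [(k q + q', q)]; both bounds for the
    quotient of the lengths follow from [0 <= q' <= q]. *)
Lemma measure_cylinder_digit n w k : size w = n ->
  let mu := @lebesgue_measure R in
  let E := cylinder n w in
  let E' := E `&` (cf_digit n.+1 @^-1` [set k]) in
  (((3 * k%:R ^+ 2)^-1)%:E * mu E <= mu E' /\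
   mu E' <= (2 / k%:R ^+ 2)%:E * mu E)%E.
Proof.
move=> <- /=; rewrite -cylinder_rcons -(size_rcons w k).
have [|nP] := boolP (all (leq 1) (rcons w k)); last first.
  rewrite [X in (_ <= X /\ X <= _)%E]measure_cylinder0//.
  (* For [k = 0] both outer terms vanish by the convention [0^-1 = 0]; otherwise the zero digit lies
     in [w], whose cylinder is itself null. *)
  have [k0|k0] := eqVneq k 0%N.
    by rewrite k0 expr0n /= mulr0 invr0 mulr0 mul0e.
  rewrite measure_cylinder0 ?mule0//; move: nP; rewrite all_rcons negb_and.
  by rewrite -eqn0Ngt (negbTE k0).
rewrite all_rcons => /andP[k1 wP].
rewrite measure_cylinder//; rewrite [X in (_ <= X /\ X <= _)%E]measure_cylinder ?all_rcons ?k1//.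
rewrite cf_den_rcons /=; have [q0 q0' qq] := cf_den_bounds wP.
set q := (cf_den w).1 in q0 qq *; set q' := (cf_den w).2 in q0' qq *.
have k1R : 1 <= k%:R :> R by rewrite ler1n.
have k0R : 0 < k%:R :> R by lra.
have kq : 0 < k%:R * q by nra.
have A0 : 0 < k%:R * q + q' by lra.
rewrite -!EFinM !lee_fin; split.
  rewrite -invfM lef_pV2 ?posrE ?mulr_gt0 ?exprn_gt0//; try lra.
  have h1 : k%:R * q + q' <= k%:R * (q + q') by nra.
  have h2 : k%:R * q + q' + q <= 3 * (k%:R * q) by nra.
  rewrite [leRHS](_ : _ = (k%:R * (q + q')) * (3 * (k%:R * q))); last ring.
  by apply: ler_pM => //; lra.
rewrite -mulrA -invfM ler_pdivlMr ?mulr_gt0 ?exprn_gt0//; try lra.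
rewrite mulrC ler_pdivrMr; last by apply: mulr_gt0; lra.
have h1 : (k%:R * q) * (k%:R * q) <= (k%:R * q + q') * (k%:R * q + q' + q).
  by apply: ler_pM; lra.
have h2 : k%:R ^+ 2 * (q * (q + q')) <= 2 * ((k%:R * q) * (k%:R * q)).
  rewrite [leRHS](_ : _ = k%:R ^+ 2 * (2 * (q * q))); last ring.
  by rewrite ler_pM2l ?exprn_gt0//; nra.
lra.
Qed.

End Cylinders.

(** * Digit processes with quasi-independent digits *)

Lemma ge0_integral_partition d (T : measurableType d) (R : realType)
    (mu : {measure set T -> \bar R}) (c : T -> nat) (f : T -> \bar R) :
  (forall i, measurable (c @^-1` [set i])) -> measurable_fun setT f ->
  (forall x, 0 <= f x)%E ->
  (\int[mu]_x f x = \sum_(i <oo) \int[mu]_(x in c @^-1` [set i]) f x)%E.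
Proof.
move=> mc mf f0.
have E : \bigcup_i (c @^-1` [set i]) = setT.
  by apply/seteqP; split => // x _; exists (c x).
rewrite -{1}E ge0_integral_bigcup ?E//; apply/trivIsetP => i j _ _ ij.
by apply/seteqP; split => // x [/= xi /eqP]; rewrite xi (negbTE ij).
Qed.

(** Numbering the words by naturals turns the partition by the first [n] digits into a series over
    [nat]. *)
Definition code_word (w : seq nat) : nat := pickle w.
Definition word_of_code i : seq nat := odflt [::] (unpickle i).
Arguments code_word : simpl never.
Arguments word_of_code : simpl never.

Lemma code_wordK : cancel code_word word_of_code.
Proof. by move=> w; rewrite /word_of_code pickleK. Qed.

Section DigitProcess.
Context d (T : measurableType d) (R : realType) (mu : {measure set T -> \bar R}).
Variable a : nat -> T -> nat.

Definition word n x : seq nat := mkseq (a^~ x) n.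
Arguments word : simpl never.
(** Under [digit_law] and for [phi] nonnegative this is, up to factors between 1/3 and 2, the
    conditional expectation of [phi (a n x)] given the earlier digits. *)
Definition sqsum (phi : nat -> R) : \bar R := (\sum_(k <oo) (phi k * sqinv k)%:E)%E.

(* At [k = 0] both factors vanish since [0^-1 = 0]: the digit 0 has probability zero. *)
Definition digit_law := forall n w k, size w = n ->
  let E := [set x | word n x = w] in
  let E' := E `&` (a n @^-1` [set k]) in
  (((3 * k%:R ^+ 2)^-1)%:E * mu E <= mu E' /\
   mu E' <= (2 / k%:R ^+ 2)%:E * mu E)%E.

Hypothesis mu1 : mu setT = 1%E.
Hypothesis ma : forall n, measurable_fun setT (a n).
Hypothesis law : digit_law.

Lemma wordS n x : word n.+1 x = rcons (word n x) (a n x).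
Proof. by rewrite /word mkseqS. Qed.

Lemma nth_word n j x : (j < n)%N -> nth 0%N (word n x) j = a j x.
Proof. by move=> jn; rewrite nth_mkseq. Qed.

Lemma measurable_digit n k : measurable (a n @^-1` [set k]).
Proof. by rewrite -[X in measurable X]setTI; exact: ma. Qed.

Lemma measurable_word n w : measurable [set x | word n x = w].
Proof.
elim: n w => [|n IH] w.
  rewrite /word /=; have [<-|wn] := pselect ([::] = w).
    by rewrite (_ : [set _ | _] = setT)//; apply/seteqP; split.
  by rewrite (_ : [set _ | _] = set0)//; apply/seteqP; split.
case/lastP: w => [|w k].
  rewrite (_ : [set _ | _] = set0)//; apply/seteqP; split => // x /=.
rewrite (_ : [set _ | _] = [set x | word n x = w] `&` (a n @^-1` [set k])).
  by apply: measurableI; [exact: IH|exact: measurable_digit].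
apply/seteqP; split => x /=; rewrite wordS; last by move=> [-> ->].
by move/rcons_inj => [].
Qed.

Lemma measurable_word_set n (P : seq nat -> Prop) : measurable [set x | P (word n x)].
Proof.
rewrite (_ : [set _ | _] =
  \bigcup_i (if pselect (P (word_of_code i))
             then [set x | word n x = word_of_code i] else set0)).
  by apply: bigcupT_measurable => i; case: pselect => ? /=; [exact: measurable_word|exact: measurable0].
apply/seteqP; split => x /=.
  by move=> Px; exists (code_word (word n x)) => //; rewrite code_wordK; case: pselect.
by move=> [i _]; case: pselect => //= Pi xw; rewrite xw.
Qed.

Lemma measurable_word_fun d' (T' : measurableType d') n (F : seq nat -> T') :
  measurable_fun setT (fun x => F (word n x)).
Proof. by move=> _ Y _; rewrite setTI; exact: (measurable_word_set n (fun w => Y (F w))). Qed.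

Lemma measurable_word_EFin n (F : seq nat -> R) :
  measurable_fun setT (fun x => (F (word n x))%:E).
Proof. exact: (measurable_word_fun n (fun w => (F w)%:E)). Qed.

Lemma measurable_word_digit n (F : seq nat -> R) (phi : nat -> R) :
  measurable_fun setT (fun x => (F (word n x) * phi (a n x))%:E).
Proof.
pose G w := F (take n w) * phi (nth 0%N w n).
have -> : (fun x => (F (word n x) * phi (a n x))%:E) = (fun x => (G (word n.+1 x))%:E).
  apply/funext => x; rewrite /G wordS -cats1 take_size_cat ?size_mkseq//.
  by rewrite nth_cat size_mkseq ltnn subnn.
exact: measurable_word_EFin.
Qed.

(** A natural that codes no word is decoded as [[::]]; the second intersection empties its term, so
    that no word is counted twice. *)
Lemma integral_word_decomp n D (F : seq nat -> R) : measurable D -> (forall w, 0 <= F w) ->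
  (\int[mu]_(x in D) (F (word n x))%:E =
   \sum_(i <oo) (F (word_of_code i))%:E *
      mu (D `&` [set x | word n x = word_of_code i] `&`
          [set x | code_word (word n x) = i]))%E.
Proof.
move=> mD F0; rewrite integral_mkcond.
rewrite (ge0_integral_partition _ (c := fun x => code_word (word n x))).
- apply: eq_eseriesr => i _; pose P := (fun x => code_word (word n x)) @^-1` [set i]; rewrite -/P.
  have mP : measurable P by exact: (measurable_word_set n (fun w => code_word w = i)).
  rewrite -integral_mkcondr setIC.
  have -> : D `&` [set x | word n x = word_of_code i] `&` [set x | code_word (word n x) = i] = D `&` P.
    apply/seteqP; split => x /=; first by move=> [[Dx _] xi].
    by move=> [Dx xi]; split => //; split => //; rewrite -xi code_wordK.
  rewrite -integral_cst; last exact: measurableI.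
  by apply: eq_integral => x; rewrite inE => -[_ /= <-]; rewrite code_wordK.
- by move=> i; exact: (measurable_word_set n (fun w => code_word w = i)).
- by apply/(measurable_restrictT _ _).1 => //; apply: measurable_funTS; exact: measurable_word_EFin.
- by move=> x; rewrite erestrict_ge0// => y _; rewrite lee_fin.
Qed.

(** [digit_law] treats a single word; weighting the words by [F] and summing extends it to every
    nonnegative function of the earlier digits. *)
Lemma digit_cond n k (F : seq nat -> R) : (forall w, 0 <= F w) ->
  ((sqinv k / 3 : R)%:E * (\int[mu]_x (F (word n x))%:E) <=
     \int[mu]_(x in a n @^-1` [set k]) (F (word n x))%:E /\
   \int[mu]_(x in a n @^-1` [set k]) (F (word n x))%:E <=
     (2 * sqinv k)%:E * \int[mu]_x (F (word n x))%:E)%E.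
Proof.
move=> F0; rewrite (integral_word_decomp n measurableT F0).
rewrite (integral_word_decomp n (measurable_digit n k) F0).
have F0' i : (0 <= (F (word_of_code i))%:E)%E by rewrite lee_fin.
have s0 := @sqinv_ge0 R k.
rewrite -!nneseriesZl; try by move=> i _; rewrite mule_ge0.
have key i : let w := word_of_code i in
   ((sqinv k / 3 : R)%:E * mu (setT `&` [set x | word n x = w] `&` [set x | code_word (word n x) = i])
     <= mu (a n @^-1` [set k] `&` [set x | word n x = w] `&` [set x | code_word (word n x) = i]) /\
   mu (a n @^-1` [set k] `&` [set x | word n x = w] `&` [set x | code_word (word n x) = i]) <=
    (2 * sqinv k)%:E * mu (setT `&` [set x | word n x = w] `&` [set x | code_word (word n x) = i]))%E.
  move=> w; rewrite setTI.
  have [wi|wi] := pselect (code_word w = i); last first.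
    rewrite (_ : _ `&` [set x | code_word (word n x) = i] = set0); last first.
      by apply/seteqP; split => // x [/= xw xi]; case: wi; rewrite -xi xw.
    rewrite (_ : _ `&` [set x | code_word (word n x) = i] = set0); last first.
      by apply/seteqP; split => // x [[_ /= xw] xi]; case: wi; rewrite -xi xw.
    by rewrite measure0 !mule0.
  have [sw|sw] := eqVneq (size w) n; last first.
    rewrite (_ : [set x | word n x = w] = set0); last first.
      by apply/seteqP; split => // x /= /(congr1 size); rewrite size_mkseq => /esym/eqP; rewrite (negbTE sw).
    by rewrite setI0 set0I measure0 !mule0.
  have -> : [set x | word n x = w] `&` [set x | code_word (word n x) = i] = [set x | word n x = w].
    by apply/seteqP; split => x /=; [case|move=> xw; rewrite xw].
  rewrite -setIA.
  have -> : [set x | word n x = w] `&` [set x | code_word (word n x) = i] = [set x | word n x = w].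
    by apply/seteqP; split => x /=; [case|move=> xw; rewrite xw].
  have := law k sw; rewrite /sqinv setIC /=.
  by rewrite invfM mulrC.
split; apply: lee_nneseries => i _.
- by rewrite !mule_ge0// lee_fin divr_ge0.
- by rewrite muleCA lee_wpmul2l//; case: (key i).
- by rewrite mule_ge0.
- by rewrite muleCA lee_wpmul2l//; case: (key i).
Qed.

Lemma integral_digit n (F : seq nat -> R) (phi : nat -> R) :
  (forall w, 0 <= F w) -> (forall k, 0 <= phi k) ->
  (\int[mu]_x (F (word n x) * phi (a n x))%:E =
   \sum_(k <oo) (phi k)%:E * \int[mu]_(x in a n @^-1` [set k]) (F (word n x))%:E)%E.
Proof.
move=> F0 p0; rewrite (ge0_integral_partition _ (c := a n)).
- apply: eq_eseriesr => k _.
  rewrite -ge0_integralZl//.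
  + by apply: eq_integral => x; rewrite inE => /= ->; rewrite EFinM muleC.
  + exact: measurable_digit.
  + by apply: measurable_funTS; exact: measurable_word_EFin.
  + by move=> x _; rewrite lee_fin.
  + by rewrite lee_fin.
- exact: measurable_digit.
- exact: measurable_word_digit.
- by move=> x; rewrite lee_fin mulr_ge0.
Qed.

Lemma sqsum_ge0 phi : (forall k, 0 <= phi k) -> (0 <= sqsum phi)%E.
Proof. by move=> p0; apply: nneseries_ge0 => k _ _; rewrite lee_fin mulr_ge0// sqinv_ge0. Qed.

Lemma measure_fin A : measurable A -> mu A \is a fin_num.
Proof.
move=> mA; rewrite ge0_fin_numE//; apply: (@le_lt_trans _ _ 1%E); last exact: ltry.
by rewrite -mu1 le_measure ?inE.
Qed.

Lemma integral_word_fin n (F : seq nat -> R) : (forall w, 0 <= F w <= 1) ->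
  exists2 r : R, 0 <= r <= 1 & (\int[mu]_x (F (word n x))%:E = r%:E)%E.
Proof.
move=> F01; set I := integral _ _ _.
have I0 : (0 <= I)%E by apply: integral_ge0 => x _; rewrite lee_fin; case/andP: (F01 (word n x)).
have I1 : (I <= 1)%E.
  rewrite -mu1 -[leRHS]mul1e -integral_cst//; apply: ge0_le_integral => //.
  - by move=> x _; rewrite lee_fin; case/andP: (F01 (word n x)).
  - exact: measurable_word_EFin.
  - by move=> x _; rewrite lee_fin; case/andP: (F01 (word n x)).
have If : I \is a fin_num by rewrite ge0_fin_numE// (le_lt_trans I1)// ltry.
by exists (fine I); rewrite -?lee_fin fineK// I0.
Qed.

Lemma markov_word n (F : seq nat -> R) (A : set T) (c : R) : measurable A -> 0 <= c ->
  (forall w, 0 <= F w) -> (forall x, A x -> c <= F (word n x)) ->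
  (c%:E * mu A <= \int[mu]_x (F (word n x))%:E)%E.
Proof.
move=> mA c0 F0 cF; rewrite -integral_cst//.
have mF D : measurable_fun D (fun x => (F (word n x))%:E).
  by apply: measurable_funTS; exact: measurable_word_EFin.
apply: (@le_trans _ _ (\int[mu]_(x in A) (F (word n x))%:E)%E).
  by apply: ge0_le_integral => // x Ax; rewrite lee_fin// cF.
by apply: ge0_subset_integral => // x _; rewrite lee_fin.
Qed.

(** This bound and its counterpart [digit_lb] replace independence: [digit_cond] is summed over the
    digit values [k] with weights [phi k]. *)
Lemma digit_ub n (F : seq nat -> R) (phi : nat -> R) :
  (forall w, 0 <= F w <= 1) -> (forall k, 0 <= phi k) ->
  (\int[mu]_x (F (word n x) * phi (a n x))%:E <=
   2%:E * sqsum phi * \int[mu]_x (F (word n x))%:E)%E.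
Proof.
move=> F01 p0; have F0 w : 0 <= F w by case/andP: (F01 w).
rewrite integral_digit//; have [r /andP[r0 _] rE] := integral_word_fin n F01.
rewrite muleAC rE -EFinM /sqsum -nneseriesZl; last by move=> k _; rewrite lee_fin mulr_ge0// sqinv_ge0.
apply: lee_nneseries => k _.
  by rewrite mule_ge0 ?lee_fin// integral_ge0// => x _; rewrite lee_fin.
apply: le_trans (lee_wpmul2l _ (digit_cond n k F0).2) _; first by rewrite lee_fin.
by rewrite rE -!EFinM lee_fin le_eqVlt; apply/orP; left; apply/eqP; ring.
Qed.

Lemma digit_lb n (F : seq nat -> R) (phi : nat -> R) :
  (forall w, 0 <= F w <= 1) -> (forall k, 0 <= phi k) ->
  (3^-1%:E * sqsum phi * \int[mu]_x (F (word n x))%:E <=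
   \int[mu]_x (F (word n x) * phi (a n x))%:E)%E.
Proof.
move=> F01 p0; have F0 w : 0 <= F w by case/andP: (F01 w).
rewrite integral_digit//; have [r /andP[r0 _] rE] := integral_word_fin n F01.
have p3 : (0 <= 3^-1 * r :> R) by rewrite mulr_ge0.
rewrite muleAC rE -EFinM /sqsum -nneseriesZl; last by move=> k _; rewrite lee_fin mulr_ge0// sqinv_ge0.
apply: lee_nneseries => k _; first by rewrite lee_fin !mulr_ge0// sqinv_ge0.
apply: le_trans _ (lee_wpmul2l _ (digit_cond n k F0).1); last by rewrite lee_fin.
by rewrite rE -!EFinM lee_fin le_eqVlt; apply/orP; left; apply/eqP; ring.
Qed.

End DigitProcess.

(** * Almost sure lower bound for digit sums *)

Section DigitSums.
Context d (T : measurableType d) (R : realType) (mu : {measure set T -> \bar R}).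
Variable a : nat -> T -> nat.
Hypothesis mu1 : mu setT = 1%E.
Hypothesis ma : forall n, measurable_fun setT (a n).
Hypothesis law : digit_law mu a.

Definition digit_sum n x : nat := \sum_(0 <= j < n) a j x.

Lemma digit_sum_word n x : digit_sum n x = \sum_(k <- word a n x) k.
Proof. by rewrite /digit_sum /word big_map /index_iota subn0. Qed.

Lemma leq_digit_sum m n x : (m <= n)%N -> (digit_sum m x <= digit_sum n x)%N.
Proof. by move=> mn; rewrite /digit_sum (big_cat_nat (n := m) (p := n))//= leq_addr. Qed.

(** Dropping digits above [M] only lowers the sum, and it keeps the contribution of one digit to the
    exponent of [laplace M] between 0 and 1. *)
Definition trunc_digit M k := if (k <= M)%N then k else 0%N.
Definition laplace M (w : seq nat) : R := expR (- ((\sum_(k <- w) trunc_digit M k)%:R / M%:R)).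

Lemma laplace01 M w : 0 <= laplace M w <= 1.
Proof. by rewrite expR_ge0 expR_le1 oppr_le0 divr_ge0. Qed.

Lemma laplace_rcons M w k :
  laplace M (rcons w k) = laplace M w * expR (- ((trunc_digit M k)%:R / M%:R)).
Proof.
rewrite /laplace -cats1 big_cat big_seq1 /= natrD mulrDl opprD expRD.
by [].
Qed.

(** On the unit interval [exp (- t) <= 1 - t / 2], and the conditional mean of a truncated digit is
    at least a third of the harmonic sum up to [M], hence at least [ln M / 3]. Finally
    [1 - t <= exp (- t)]. *)
Lemma laplace_step M n : (0 < M)%N ->
  (\int[mu]_x (laplace M (word a n.+1 x))%:E <=
   (expR (- (ln M%:R / (6 * M%:R))))%:E * \int[mu]_x (laplace M (word a n x))%:E)%E.
Proof.
move=> M0; have M1 : 1 <= M%:R :> R by rewrite ler1n.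
pose phi k : R := expR (- ((trunc_digit M k)%:R / M%:R)).
pose psi k : R := (trunc_digit M k)%:R / M%:R / 2.
have tM k : 0 <= (trunc_digit M k)%:R / M%:R :> R /\ (trunc_digit M k)%:R / M%:R <= 1 :> R.
  split; first by rewrite divr_ge0.
  rewrite ler_pdivrMr ?mul1r ?ler_nat; last lra.
  by rewrite /trunc_digit; case: ifP.
have psi0 k : 0 <= psi k by case: (tM k) => ? ?; rewrite divr_ge0.
have phi0 k : 0 <= phi k by exact: expR_ge0.
have L0 w : 0 <= laplace M w by case/andP: (laplace01 M w).
have Lstep x : laplace M (word a n.+1 x) = laplace M (word a n x) * phi (a n x).
  by rewrite wordS laplace_rcons.
(* Written as a sum, to avoid subtracting extended reals. *)
have sum1 : (\int[mu]_x (laplace M (word a n.+1 x))%:E +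
    \int[mu]_x (laplace M (word a n x) * psi (a n x))%:E <=
    \int[mu]_x (laplace M (word a n x))%:E)%E.
  rewrite -ge0_integralD//; last 4 first.
  - by move=> x _; rewrite lee_fin.
  - exact: (measurable_word_EFin ma).
  - by move=> x _; rewrite lee_fin mulr_ge0.
  - exact: (measurable_word_digit ma).
  apply: ge0_le_integral => //.
  - by move=> x _; rewrite adde_ge0// lee_fin// mulr_ge0.
  - by apply: emeasurable_funD; [exact: (measurable_word_EFin ma)|exact: (measurable_word_digit ma)].
  - exact: (measurable_word_EFin ma).
  - move=> x _; rewrite -EFinD lee_fin Lstep -mulrDr ler_piMr//.
    by have := expRN_le (introT andP (tM (a n x))); rewrite /phi /psi; lra.
have psiQ : ((ln M%:R / (2 * M%:R))%:E <= sqsum psi)%E.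
  apply: le_trans _ (sum_le_nneseries M.+1 _); last first.
    by move=> k; rewrite lee_fin mulr_ge0// sqinv_ge0.
  rewrite sumEFin lee_fin big_ltn// /psi {1}/trunc_digit /= mul0r mul0r mul0r add0r.
  rewrite [leRHS](_ : _ = (\sum_(1 <= k < M.+1) k%:R^-1) / (2 * M%:R)).
    by rewrite ler_wpM2r ?ln_harmonic_le// invr_ge0; lra.
  rewrite mulr_suml; apply: eq_big_nat => k /andP[k1 kM].
  rewrite /trunc_digit -ltnS kM /sqinv.
  have : 1 <= k%:R :> R by rewrite ler1n.
  by move=> k1R; field; rewrite !gt_eqF//; lra.
have [r /andP[r0 _] rE] := integral_word_fin mu1 ma n (laplace01 M).
have [s _ sE] := integral_word_fin mu1 ma n.+1 (laplace01 M).
have := digit_lb mu1 ma law n (laplace01 M) psi0.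
rewrite sE rE in sum1 *; move=> lb.
have lb2 : ((3^-1 * (ln M%:R / (2 * M%:R)) * r)%:E <= \int[mu]_x (laplace M (word a n x) * psi (a n x))%:E)%E.
  apply: le_trans lb; rewrite !EFinM lee_wpmul2r ?lee_fin// lee_wpmul2l// lee_fin//.
have := le_trans (leeD (lexx s%:E) lb2) sum1.
rewrite -EFinD !lee_fin => h.
apply: (@le_trans _ _ ((1 - ln M%:R / (6 * M%:R)) * r)).
  by move: h; rewrite (_ : 3^-1 * (ln M%:R / (2 * M%:R)) = ln M%:R / (6 * M%:R) :> R); [lra|field; lra].
by rewrite ler_wpM2r//; have := expR_ge1Dx (- (ln M%:R / (6 * M%:R)) : R); lra.
Qed.

Lemma laplace_le M n : (0 < M)%N ->
  (\int[mu]_x (laplace M (word a n x))%:E <= (expR (- (n%:R * (ln M%:R / (6 * M%:R)))))%:E)%E.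
Proof.
move=> M0; elim: n => [|n IH].
  rewrite mul0r oppr0 expR0; have [r /andP[_ r1] ->] := integral_word_fin mu1 ma 0 (laplace01 M).
  by rewrite lee_fin.
apply: (le_trans (laplace_step n M0)).
apply: (le_trans (lee_wpmul2l _ IH)); first by rewrite lee_fin expR_ge0.
by rewrite -EFinM -expRD lee_fin ler_expR -natr1; lra.
Qed.

Lemma measurable_digit_sum_le n (c : R) : measurable [set x | (digit_sum n x)%:R <= c].
Proof.
rewrite (_ : [set _ | _] = [set x | (\sum_(k <- word a n x) k)%:R <= c]).
  exact: (measurable_word_set ma n (fun w => (\sum_(k <- w) k)%:R <= c)).
by apply/seteqP; split => x /=; rewrite digit_sum_word.
Qed.

(** With [48 M] digits the Laplace transform is at most [M ^ -8], while on the event the integrand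
    is at least [M ^ -4]; Markov's inequality gives [M ^ -4], more than enough for summability. *)
Lemma digit_sum_small_prob M : (0 < M)%N ->
  (mu [set x | ((digit_sum (48 * M) x)%:R <= 4 * M%:R * ln M%:R :> R)%R] <= (sqinv M)%:E)%E.
Proof.
move=> M0; set A := [set x | _]; have M1 : 1 <= M%:R :> R by rewrite ler1n.
have L0 w : 0 <= laplace M w by case/andP: (laplace01 M w).
have c0 : 0 <= expR (- (4 * ln M%:R)) :> R by exact: expR_ge0.
have := markov_word mu ma (measurable_digit_sum_le _ _ : measurable A) c0 L0 _.
move=> /(_ (48 * M)%N) h.
have {}h : ((expR (- (4 * ln M%:R)))%:E * mu A <= (expR (- (8 * ln M%:R)))%:E)%E.
  apply: le_trans (h _) _; last first.
    apply: le_trans (laplace_le _ M0) _; rewrite lee_fin ler_expR natrM.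
    by rewrite le_eqVlt; apply/orP; left; apply/eqP; field; lra.
  move=> x Ax; rewrite ler_expR lerN2 ler_pdivrMr; last lra.
  rewrite mulrAC; apply: le_trans Ax; rewrite ler_nat digit_sum_word.
  by apply: leq_sum => k _; rewrite /trunc_digit; case: ifP.
have Af : mu A \is a fin_num.
  by apply: (measure_fin mu1); exact: measurable_digit_sum_le.
rewrite -(fineK Af) in h *; move: h; rewrite -EFinM !lee_fin => h.
apply: (@le_trans _ _ (expR (- (4 * ln M%:R)))).
  rewrite -(ler_pM2l (expR_gt0 (- (4 * ln M%:R)))) -expRD; apply: le_trans h _.
  by rewrite ler_expR; lra.
have lnM0 : 0 <= ln M%:R :> R by exact: ln_ge0.
apply: (@le_trans _ _ (expR (- (2%:R * ln M%:R)))); first by rewrite ler_expR; lra.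
by rewrite expRN expRM_natl lnK// posrE; lra.
Qed.

(** Borel-Cantelli along the multiples of 48; monotonicity of the sums fills the gaps. *)
Lemma digit_sum_lower :
  {ae mu, forall x, exists N, forall n, (N <= n)%N ->
     n%:R * ln n%:R <= 48 * (digit_sum n x)%:R :> R}.
Proof.
pose F i := [set x | (digit_sum (48 * i.+1) x)%:R <= 4 * i.+1%:R * ln i.+1%:R :> R].
have mF i : measurable (F i) by exact: measurable_digit_sum_le.
exists (lim_sup_set F); split.
- by apply: bigcap_measurable => // n _; apply: bigcup_measurable.
- apply: lim_sup_set_cvg0 => //; apply: (@le_lt_trans _ _ 2%:E); last exact: ltry.
  apply: nneseries_le_bound => // n.
  apply: (@le_trans _ _ (\sum_(0 <= i < n) (sqinv i.+1)%:E)%E).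
    by apply: lee_sum => i _; exact: digit_sum_small_prob.
  rewrite sumEFin lee_fin; apply: le_trans (sum_sqinv_le2 R n.+1).
  by rewrite big_nat_recl// sqinv0 add0r.
move=> x /= nx; apply: contrapT => nF; apply: nx.
have [N HN] : exists N, forall j, (N <= j)%N -> ~ F j x.
  apply: contrapT => nN; apply: nF => n _.
  apply: contrapT => h; apply: nN; exists n => j nj Fj; apply: h.
  by exists j.
(* This makes [M = n %/ 48] large enough for [n <= 96 M] and [n <= M ^ 2], so that
   [n ln n <= 192 M ln M], which is 48 times the bound [4 M ln M]. *)
exists (48 * (N + 97))%N => n nN.
set M := (n %/ 48)%N.
have nM : (48 * M <= n < 48 * M.+1)%N by lia.
have M96 : (N + 97 <= M)%N by lia.
have MP : 1 <= M%:R :> R by rewrite ler1n; lia.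
have lnM0 : 0 <= ln M%:R :> R by exact: ln_ge0.
have nF' := HN M.-1 ltac:(lia).
have {}nF' : 4 * M%:R * ln M%:R < (digit_sum (48 * M) x)%:R :> R.
  by move: nF'; rewrite /F /= prednK; [move/negP; rewrite -ltNge|lia].
have h1 : n%:R <= 96 * M%:R :> R by rewrite -natrM ler_nat; lia.
have h2 : ln n%:R <= 2 * ln M%:R :> R.
  rewrite [leRHS](_ : _ = ln (M%:R * M%:R)); last by rewrite lnM ?posrE; lra.
  rewrite -natrM ler_ln ?posrE ?ltr0n ?ler_nat; nia.
have h3 : (digit_sum (48 * M) x)%:R <= (digit_sum n x)%:R :> R.
  by rewrite ler_nat leq_digit_sum//; case/andP: nM.
apply: (@le_trans _ _ (96 * M%:R * (2 * ln M%:R))).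
  by apply: ler_pM => //; rewrite ln_ge0// ler1n; lia.
lra.
Qed.

End DigitSums.

(** * Upper bound in probability for digit sums *)

Section BorelCantelli.
Context d (T : measurableType d) (R : realType) (mu : {measure set T -> \bar R}).
Variable a : nat -> T -> nat.
Hypothesis mu1 : mu setT = 1%E.
Hypothesis ma : forall n, measurable_fun setT (a n).
Hypothesis law : digit_law mu a.

Lemma integral_digit_pred n (P : pred nat) :
  (\int[mu]_x ((P (a n x))%:R : R)%:E = mu [set x | P (a n x)])%E.
Proof.
have mP : measurable [set x | P (a n x)].
  by have := ma n measurableT (Y := [set k | P k]) I; rewrite setTI.
rewrite -[X in mu X]setIT -integral_indic//.
by apply: eq_integral => x _; rewrite indicE mem_setE.
Qed.

Lemma integral_digit_le n (f : nat -> R) : (forall k, 0 <= f k) ->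
  (\int[mu]_x (f (a n x))%:E <= 2%:E * sqsum f)%E.
Proof.
move=> f0; have := digit_ub mu1 ma law n (F := fun=> 1) (phi := f) _ f0.
rewrite integral_cst//= mul1e mu1 mule1.
under eq_integral do rewrite mul1r.
by apply => _; rewrite ler01 lexx.
Qed.

Lemma digit_pred_prob n (P : pred nat) :
  (mu [set x | P (a n x)] <= 2%:E * sqsum (fun k => (P k)%:R : R))%E.
Proof. by rewrite -integral_digit_pred; apply: (@integral_digit_le _ (fun k => (P k)%:R)). Qed.

Lemma sqsum_pred_le2 (P : pred nat) : (sqsum (fun k => (P k)%:R : R) <= 2%:E)%E.
Proof.
apply: nneseries_le_bound => [k|n]; first by rewrite lee_fin mulr_ge0// sqinv_ge0.
rewrite sumEFin lee_fin; apply: le_trans (sum_sqinv_le2 R n).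
by apply: ler_sum => k _; rewrite ler_piMl ?sqinv_ge0//; case: (P k).
Qed.

Lemma sqsum_pred_fin (P : pred nat) : sqsum (fun k => (P k)%:R : R) \is a fin_num.
Proof.
rewrite ge0_fin_numE ?sqsum_ge0//; apply: le_lt_trans (sqsum_pred_le2 P) _.
exact: ltry.
Qed.

(** Over a word these values add up to at least 1 as soon as the digit sum reaches [c] or some digit
    exceeds [m], so one first moment controls both events. *)
Definition capped_digit (m : nat) (c : R) (k : nat) : R := if (k <= m)%N then k%:R / c else 1.

Lemma sqsum_capped_digit m c : (0 < m)%N -> 0 < c ->
  (sqsum (capped_digit m c) <= ((1 + ln m%:R) / c + m%:R^-1)%:E)%E.
Proof.
move=> m0 c0.
have f0 k : 0 <= capped_digit m c k by rewrite /capped_digit; case: ifP => // _; rewrite divr_ge0// ltW.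
have u0 k : 0 <= capped_digit m c k * sqinv k by rewrite mulr_ge0// sqinv_ge0.
apply: nneseries_le_bound => [k|n]; first by rewrite lee_fin.
rewrite sumEFin lee_fin.
apply: (@le_trans _ _ (\sum_(0 <= k < m.+1 + n) capped_digit m c k * sqinv k)).
  by rewrite [leRHS](big_cat_nat (n := n))//=; [rewrite lerDl sumr_ge0|lia].
rewrite (big_cat_nat (n := m.+1))//=; last lia.
rewrite big_ltn// {1}sqinv0 mulr0 add0r; apply: lerD.
  apply: (@le_trans _ _ ((\sum_(1 <= k < m.+1) k%:R^-1) / c)).
    rewrite mulr_suml le_eqVlt; apply/orP; left; apply/eqP; apply: eq_big_nat => k /andP[k1 km].
    rewrite /capped_digit -ltnS km /sqinv.
    have : 1 <= k%:R :> R by rewrite ler1n.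
    by move=> k1R; field; rewrite !gt_eqF//; lra.
  by rewrite ler_wpM2r ?invr_ge0 ?harmonic_le_ln// ltW.
apply: le_trans (sum_sqinv_tail R (m.+1 + n) m0).
rewrite le_eqVlt; apply/orP; left; apply/eqP; apply: eq_big_nat => k /andP[km _].
by rewrite /capped_digit leqNgt km /= mul1r.
Qed.

Lemma integral_digit_sum_le n (f : nat -> R) : (forall k, 0 <= f k) ->
  (\int[mu]_x (\sum_(k <- word a n x) f k)%:E <= n%:R%:E * (2%:E * sqsum f))%E.
Proof.
move=> f0; have f0' w : 0 <= \sum_(k <- w) f k by rewrite sumr_ge0.
have Q0 : (0 <= 2%:E * sqsum f)%E by rewrite mule_ge0// sqsum_ge0.
elim: n => [|n IH].
  by under eq_integral do rewrite big_nil; rewrite integral0 mul0e.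
have mW := measurable_word_EFin ma (R := R).
have mn : measurable_fun setT (fun x => (f (a n x))%:E).
  have := measurable_word_digit ma n (fun=> 1) f.
  by under eq_fun do rewrite mul1r.
under eq_integral do rewrite wordS -cats1 big_cat big_seq1 EFinD.
rewrite ge0_integralD//; [|by move=> x _; rewrite lee_fin|exact: (mW n (fun w => \sum_(k <- w) f k))|by move=> x _; rewrite lee_fin].
rewrite -natr1 EFinD ge0_muleDl ?lee_fin// mul1e.
by apply: leeD => //; exact: integral_digit_le.
Qed.

(** Markov's inequality for the capped sum with [m = D n] and [c = C n ln n] leaves
    [2 (1 + ln D + ln n) / (C ln n) + 2 / D]. First [D], then [C] is chosen to make each part at
    most [eps / 2]; [4 <= n] ensures [1 <= ln n]. *)
Lemma digit_sum_upper (eps : R) : 0 < eps -> exists C N : nat, forall n, (N <= n)%N ->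
  (mu [set x | (C%:R * (n%:R * ln n%:R) < (digit_sum a n x)%:R :> R)%R] <= eps%:E)%E.
Proof.
move=> e0; pose D := (Num.truncn (4 / eps)).+1; have D0 : 1 <= D%:R :> R by rewrite ler1n.
have De : 2 / D%:R <= eps / 2.
  have : 4 / eps < D%:R by exact: truncnS_gt.
  rewrite ltr_pdivrMr// => h; rewrite ler_pdivrMr; lra.
have lD : 0 <= ln (D%:R : R) by exact: ln_ge0.
pose C := (Num.truncn (4 * (2 + ln D%:R) / eps)).+1; have C0 : 1 <= C%:R :> R by rewrite ler1n.
have Ce : 2 * (2 + ln D%:R) / C%:R <= eps / 2.
  have : 4 * (2 + ln D%:R) / eps < C%:R by exact: truncnS_gt.
  rewrite ltr_pdivrMr// => h; rewrite ler_pdivrMr; lra.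
exists C, 4%N => n n4.
have n4R : 4 <= n%:R :> R by rewrite (ler_nat _ 4).
have ln1 : 1 <= ln (n%:R : R).
  apply: (@le_trans _ _ (ln 4)); last by rewrite ler_ln ?posrE//; lra.
  rewrite (_ : 4 = 2 * 2 :> R); last by rewrite -natrM.
  by rewrite lnM ?posrE//; have /andP[+ _] := @ln_ratio R 1 isT; rewrite ln1; lra.
set c : R := C%:R * (n%:R * ln n%:R); have c0 : 0 < c by rewrite !mulr_gt0//; lra.
pose m := (D * n)%N; have m0 : (0 < m)%N by rewrite muln_gt0; lia.
have f0 k : 0 <= capped_digit m c k by rewrite /capped_digit; case: ifP => // _; rewrite divr_ge0// ltW.
set A := [set x | _].
have mA : measurable A.
  rewrite (_ : A = ~` [set x | (digit_sum a n x)%:R <= c]); first exact/measurableC/measurable_digit_sum_le.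
  by apply/seteqP; split => x; rewrite /A /= ltNge => /negP.
have := markov_word mu ma (n := n) (F := fun w => \sum_(k <- w) capped_digit m c k) mA ler01.
rewrite mul1e => /(_ _ _)/le_trans; apply.
- by move=> w; rewrite sumr_ge0.
- move=> x; rewrite /A /= digit_sum_word => cS.
  have [/allP small|/allPn[k kw km]] := boolP (all (fun k => (k <= m)%N) (word a n x)).
    rewrite (eq_big_seq (fun k => k%:R / c)); last by move=> k /small km; rewrite /capped_digit km.
    by rewrite -mulr_suml -natr_sum ler_pdivlMr// mul1r ltW.
  rewrite (big_rem k kw) /= {1}/capped_digit (negbTE km) lerDl sumr_ge0//.
apply: (le_trans (integral_digit_sum_le n f0)).
apply: (@le_trans _ _ (n%:R%:E * (2%:E * ((1 + ln m%:R) / c + m%:R^-1)%:E))%E).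
  by rewrite lee_wpmul2l ?lee_fin// lee_wpmul2l ?lee_fin// sqsum_capped_digit.
rewrite -!EFinM lee_fin /c /m natrM lnM ?posrE; try lra.
set ln' := ln (n%:R : R) in ln1 *.
rewrite [leLHS](_ : _ = 2 * (1 + (ln D%:R + ln')) / (C%:R * ln') + 2 / D%:R); last first.
  by field; rewrite !gt_eqF//; lra.
suff : 2 * (1 + (ln D%:R + ln')) / (C%:R * ln') <= 2 * (2 + ln D%:R) / C%:R by lra.
rewrite ler_pdivrMr; last by rewrite mulr_gt0//; lra.
rewrite mulrA divfK; last by rewrite gt_eqF; lra.
by rewrite -mulrA ler_pM2l//; nra.
Qed.

End BorelCantelli.

(** * A conditional Borel-Cantelli lemma *)

Section ConditionalBorelCantelli.
Context d (T : measurableType d) (R : realType) (mu : {measure set T -> \bar R}).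
Variable a : nat -> T -> nat.
Hypothesis mu1 : mu setT = 1%E.
Hypothesis ma : forall n, measurable_fun setT (a n).
Hypothesis law : digit_law mu a.

(** Formulated on words, so that its indicator is a function of the earlier digits as [digit_lb]
    requires; [A j] tests digit [j], and [B j] the digits before it. *)
Definition avoids (A : nat -> pred nat) (B : nat -> pred (seq nat)) N n (w : seq nat) :=
  all (fun j => ~~ (A j (nth 0%N w j) && B j (take j w))) (index_iota N n).

Lemma avoids_word A B N n x :
  avoids A B N n (word a n x) = all (fun j => ~~ (A j (a j x) && B j (word a j x))) (index_iota N n).
Proof.
apply: eq_in_all => j; rewrite mem_index_iota => /andP[_ jn].
by rewrite nth_word// /word /mkseq -map_take take_iota (minn_idPl (ltnW jn)).
Qed.

Lemma avoids_wordS A B N n x : (N <= n)%N ->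
  avoids A B N n.+1 (word a n.+1 x) =
  avoids A B N n (word a n x) && ~~ (A n (a n x) && B n (word a n x)).
Proof.
move=> Nn; rewrite !avoids_word /index_iota subSn// -addn1 iotaD all_cat /= andbT subnKC//.
Qed.

(* In short [u_(n+1) <= u_n - p_n / 3 * (u_n - eps)], where [u_n] is the probability
   of avoidance up to [n] and [p_n] the weight of [A n]; if the [p_n] have infinite
   sum this forces [lim u_n <= eps]. *)
Lemma avoids_step (A : nat -> pred nat) (B : nat -> pred (seq nat)) N n (eps : R) : (N <= n)%N ->
  (mu [set x | ~~ B n (word a n x)] <= eps%:E)%E ->
  (\int[mu]_x ((avoids A B N n.+1 (word a n.+1 x))%:R : R)%:E +
    (3^-1 * fine (sqsum (fun k => (A n k)%:R : R)) *
       (fine (\int[mu]_x ((avoids A B N n (word a n x))%:R : R)%:E) - eps))%:E <=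
   \int[mu]_x ((avoids A B N n (word a n x))%:R : R)%:E)%E.
Proof.
move=> Nn Be.
pose F w : R := (avoids A B N n w)%:R; pose G w : R := (avoids A B N n w && B n w)%:R.
pose phi k : R := (A n k)%:R.
have b01 (b : bool) : 0 <= (b%:R : R) <= 1 by case: b; rewrite ?lexx ?ler01.
have b0 (b : bool) : 0 <= (b%:R : R) by [].
have mW := measurable_word_EFin ma (R := R).
have [f f01 fE] := integral_word_fin mu1 ma n (F := F) (fun w => b01 _).
have [g g01 gE] := integral_word_fin mu1 ma n (F := G) (fun w => b01 _).
have [s s01 sE] := integral_word_fin mu1 ma n.+1 (F := fun w => (avoids A B N n.+1 w)%:R) (fun w => b01 _).
have lb := digit_lb mu1 ma law n (F := G) (phi := phi) (fun w => b01 _) (fun w => b0 _).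
rewrite /F in fE; rewrite fE sE /=.
(* Avoidance up to [n] either continues or ends at [n], where both [A n] and [B n] must hold. *)
have split1 : (s%:E + \int[mu]_x (G (word a n x) * phi (a n x))%:E = f%:E)%E.
  rewrite -fE -sE -ge0_integralD//.
  - apply: eq_integral => x _; rewrite -EFinD; congr EFin.
    rewrite avoids_wordS// /G /phi.
    by case: (avoids _ _ _ _ _); case: (A n _); case: (B n _); rewrite /= ?mulr0 ?mul0r ?mulr1 ?addr0 ?add0r.
  - exact: (mW n.+1 (fun w => (avoids A B N n.+1 w)%:R)).
  - by move=> x _; rewrite lee_fin mulr_ge0// b0.
  - exact: (measurable_word_digit ma).
have split2 : (f%:E <= g%:E + eps%:E)%E.
  apply: (@le_trans _ _ (g%:E + mu [set x | ~~ B n (word a n x)])%E); last by rewrite leeD2l.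
  have mB : measurable [set x | ~~ B n (word a n x)] := measurable_word_set ma n (fun w => ~~ B n w).
  rewrite -[X in (_ + mu X)%E]setIT -integral_indic// -fE -gE -ge0_integralD//.
  - apply: ge0_le_integral => //.
    + exact: (mW n (fun w => (avoids A B N n w)%:R)).
    + apply: emeasurable_funD; first exact: (mW n G).
      by apply/measurable_EFinP; exact: measurable_indic.
    + move=> x _; rewrite -EFinD lee_fin indicE mem_setE /G unfold_in.
      by case: (avoids _ _ _ _ _); case: (B n _) => /=; rewrite ?addr0 ?add0r ?lexx ?ler01.
  - by move=> x _; rewrite lee_fin b0.
  - by apply/measurable_EFinP; exact: measurable_indic.
move: split2; rewrite -EFinD lee_fin => fg.
have Qf := @sqsum_pred_fin R (A n).
have Q0 : 0 <= fine (sqsum (fun k => (A n k)%:R : R)) by rewrite fine_ge0// sqsum_ge0.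
rewrite -split1; apply: leeD => //; apply: le_trans lb.
rewrite gE -[X in (_ * X * _)%E]fineK// -!EFinM lee_fin /phi.
by rewrite ler_wpM2l ?mulr_ge0 ?invr_ge0//; lra.
Qed.

(** If the measure [v] of [G] exceeded [eps], all avoidance probabilities [u n] would be at least
    [v], so step [n] would lower them by at least [p n (v - eps) / 3]. The total drop is at most 1,
    which would bound the divergent sum of the [p n]. *)
Lemma conditional_borel_cantelli (A : nat -> pred nat) (B : nat -> pred (seq nat)) N (eps : R) (G : set T) :
  (\sum_(n <oo) sqsum (fun k => (A n k)%:R : R) = +oo)%E ->
  (forall n, (N <= n)%N -> mu [set x | ~~ B n (word a n x)] <= eps%:E)%E ->
  measurable G ->
  (forall x, G x -> forall n, (N <= n)%N -> ~~ (A n (a n x) && B n (word a n x))) ->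
  (mu G <= eps%:E)%E.
Proof.
move=> Aoo Be mG GAB.
pose u n : R := fine (\int[mu]_x ((avoids A B N n (word a n x))%:R : R)%:E).
pose p n : R := fine (sqsum (fun k => (A n k)%:R : R)).
have b01 (b : bool) : 0 <= (b%:R : R) <= 1 by case: b; rewrite ?lexx ?ler01.
have Qf n := @sqsum_pred_fin R (A n).
have p0 n : 0 <= p n by rewrite fine_ge0// sqsum_ge0.
have uE n : ((\int[mu]_x ((avoids A B N n (word a n x))%:R : R)%:E) = (u n)%:E)%E.
  have [f f01 fE] := integral_word_fin mu1 ma n (F := fun w => (avoids A B N n w)%:R) (fun w => b01 _).
  by rewrite /u fE.
have u01 n : 0 <= u n <= 1.
  have [f f01 fE] := integral_word_fin mu1 ma n (F := fun w => (avoids A B N n w)%:R) (fun w => b01 _).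
  by rewrite /u fE.
have Gf := measure_fin mu1 mG; rewrite -(fineK Gf) lee_fin; set v := fine (mu G).
have vu n : v <= u n.
  have := markov_word mu ma (n := n) (F := fun w => (avoids A B N n w)%:R) mG ler01.
  rewrite mul1e uE -(fineK Gf) lee_fin; apply => [w|x Gx]; first by case/andP: (b01 (avoids A B N n w)).
  rewrite (_ : avoids _ _ _ _ _)//= avoids_word; apply/allP => j.
  by rewrite mem_index_iota => /andP[Nj _]; exact: GAB.
have step n : (N <= n)%N -> u n.+1 + 3^-1 * p n * (u n - eps) <= u n.
  by move=> Nn; have := avoids_step A Nn (Be n Nn); rewrite !uE -/(p n) /= -EFinD lee_fin.
rewrite leNgt; apply/negP => ev.
have sumb m : \sum_(N <= n < N + m) (p n * (v - eps) / 3) <= u N - u (N + m)%N.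
  elim: m => [|m IH]; first by rewrite addn0 big_geq// subrr.
  rewrite addnS big_nat_recr ?leq_addr//=.
  have := step (N + m)%N (leq_addr _ _); have := vu (N + m)%N; have := p0 (N + m)%N.
  have := u01 (N+m)%N; set pp := p _; set uu := u (N + m)%N in IH *; set uu' := u _ => _ pp0 vuu.
  have : pp * (v - eps) <= pp * (uu - eps) by rewrite ler_wpM2l//; lra.
  by lra.
suff : (\sum_(n <oo) sqsum (fun k => (A n k)%:R : R) <= (2 * N%:R + 3 / (v - eps))%:E)%E.
  by rewrite Aoo leye_eq.
apply: nneseries_le_bound => [k|n]; first by rewrite sqsum_ge0.
rewrite (eq_bigr (fun k => (p k)%:E)); last by move=> k _; rewrite /p fineK.
rewrite sumEFin lee_fin.
apply: (@le_trans _ _ (\sum_(0 <= k < N + n) p k)).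
  by rewrite [leRHS](big_cat_nat (n := n))//=; [rewrite lerDl sumr_ge0|lia].
rewrite (big_cat_nat (n := N))//=; last lia.
apply: lerD.
  apply: (@le_trans _ _ (\sum_(0 <= k < N) (2 : R))).
    by apply: ler_sum => k _; rewrite -lee_fin /p fineK//; exact: sqsum_pred_le2.
  by rewrite big_const_nat iter_addr subn0 addr0 mulr_natr.
rewrite ler_pdivlMr ?subr_gt0//.
have := sumb n; rewrite -mulr_suml -mulr_suml.
have /andP[_ h1] := u01 N; have /andP[h2 _] := u01 (N + n)%N.
by set X := \sum_(_ <= _ < _) _; set Y := _ * (v - eps); lra.
Qed.

End ConditionalBorelCantelli.

(** * Counting the solutions of inequalities between [n ln n] and [X] *)

Section Growth.
Variable R : realType.
Implicit Types X Y : R.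

(** The order of magnitude of the number of [n] with [n ln n < X]. *)
Definition over_ln X := X / ln X.

Lemma over_ln_ge1 X : 1 < X -> 1 <= over_ln X.
Proof.
move=> X1; rewrite /over_ln ler_pdivlMr ?ln_gt0// mul1r ltW// ln_sublinear//; lra.
Qed.

Lemma ln3_gt : 1 < 2 * ln (3 : R).
Proof.
have /andP[h1 _] := @ln_ratio R 1 isT; have /andP[h2 _] := @ln_ratio R 2 isT.
by move: h1 h2; rewrite ln1; lra.
Qed.

(** Such an [n] is at most [2 m X / ln X]: if [n] is at least the square root of [m X], then [ln n]
    is at least [ln X / 2]; a smaller [n] satisfies the bound anyway. The extra 1 in the constant
    pays for [n = 0]. *)
Lemma nlnn_count_ub X m : 1 < X -> (0 < m)%N ->
  (\sum_(n <oo) ((n%:R * ln n%:R < m%:R * X)%R%:R : R)%:E <= ((2 * m%:R + 1) * over_ln X)%:E)%E.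
Proof.
move=> X1 m0; have m1 : 1 <= m%:R :> R by rewrite ler1n.
have lX : 0 < ln X by exact: ln_gt0.
have h1 := over_ln_ge1 X1.
set B := 2 * m%:R * over_ln X.
have B0 : 0 <= B by rewrite /B; nra.
have nB n : n%:R * ln n%:R < m%:R * X -> n%:R <= B.
  move=> nX; have [->|n0] := posnP n; first exact: B0.
  have n1 : 1 <= n%:R :> R by rewrite ler1n.
  rewrite /B /over_ln mulrA ler_pdivlMr//.
  pose r := Num.sqrt (m%:R * X).
  have Y0 : 0 <= m%:R * X by rewrite mulr_ge0//; lra.
  have r0 : 0 <= r by exact: sqrtr_ge0.
  have rr : r * r = m%:R * X by rewrite -expr2 sqr_sqrtr.
  have r1 : 0 < r by rewrite sqrtr_gt0; nra.
  have lY : ln X <= 2 * ln r.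
    have -> : 2 * ln r = ln (m%:R * X) by rewrite -rr lnM ?posrE//; ring.
    have XX : X <= m%:R * X by nra.
    by rewrite ler_ln ?posrE//; lra.
  have [nr|rn] := ltP (n%:R : R) r.
    have := ln_sublinear r1; nra.
  have : ln r <= ln n%:R by rewrite ler_ln ?posrE//; lra.
  nra.
apply: (@le_trans _ _ ((Num.truncn B).+1%:R)%:E); last first.
  have hB : (Num.truncn B)%:R <= B by rewrite truncn_le.
  rewrite lee_fin -natr1.
  by rewrite mulrDl mul1r; apply: lerD.
apply: nneseries_le_bound => [k|N]; first by rewrite lee_fin.
rewrite sumEFin lee_fin.
apply: (@le_trans _ _ (\sum_(0 <= n < N) ((n < (Num.truncn B).+1)%N%:R : R))).
  apply: ler_sum => n _; have [/nB nlB|_] := boolP (n%:R * ln n%:R < m%:R * X); last exact: ler0n.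
  by rewrite (_ : (n < _)%N)// ltnS truncn_ge_nat.
rewrite -natr_sum ler_nat.
elim: N => [|N IH]; first by rewrite big_geq.
suff : (\sum_(0 <= n < N.+1) (n < (Num.truncn B).+1) <= minn N.+1 (Num.truncn B).+1)%N by lia.
elim: N.+1 => [|k IHk]; first by rewrite big_geq.
by rewrite big_nat_recr//=; case: ltnP; lia.
Qed.

(** Every [n] up to [X / (2 m ln X)] qualifies: [n < X], as [2 ln X > 1], and then [m n ln n] is at
    most half of [X]. *)
Lemma nlnn_count_lb X m : 3 < X -> (0 < m)%N ->
  ((over_ln X / (2 * m%:R))%:E <= \sum_(n <oo) ((m%:R * (n%:R * ln n%:R) < X)%R%:R : R)%:E)%E.
Proof.
move=> X3 m0; have m1 : 1 <= m%:R :> R by rewrite ler1n.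
have lX : 1 < 2 * ln X.
  by apply: lt_trans ln3_gt _; rewrite ltr_pM2l// ltr_ln ?posrE//; lra.
set B := over_ln X / _.
have B0 : 0 <= B by rewrite /B /over_ln divr_ge0 ?divr_ge0//; lra.
apply: le_trans (sum_le_nneseries (Num.truncn B).+1 _); last by move=> k; rewrite lee_fin.
rewrite sumEFin lee_fin big_mkord.
rewrite (eq_bigr (fun=> 1)).
  by rewrite sumr_const card_ord ltW// truncnS_gt.
move=> [n /=]; rewrite ltnS truncn_ge_nat// /B /over_ln => nB _.
rewrite (_ : (_ < X)%R)//.
rewrite -mulrA -invfM ler_pdivlMr in nB; last by nra.
have [->|n0] := posnP n; first by rewrite mul0r mulr0; lra.
have n1 : 1 <= n%:R :> R by rewrite ler1n.
have lm : 1 < ln X * (2 * m%:R) by nra.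
have nX : n%:R < X by nra.
have nm : 0 < n%:R * m%:R :> R by rewrite mulr_gt0; lra.
have lnX : ln n%:R < ln X by rewrite ltr_ln ?posrE//; lra.
have : n%:R * m%:R * ln n%:R < n%:R * m%:R * ln X by rewrite ltr_pM2l.
have : 0 < n%:R * m%:R * ln X by rewrite mulr_gt0//; lra.
lra.
Qed.

Lemma sum_sqsum_pred (P : nat -> pred nat) :
  (\sum_(n <oo) sqsum (fun k => (P n k)%:R : R) =
   \sum_(k <oo) (sqinv k)%:E * \sum_(n <oo) ((P n k)%:R : R)%:E)%E.
Proof.
rewrite /sqsum nneseries_interchange//; last first.
  by move=> i j; rewrite lee_fin mulr_ge0// sqinv_ge0.
apply: eq_eseriesr => k _; rewrite -nneseriesZl//.
by apply: eq_eseriesr => n _; rewrite EFinM muleC.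
Qed.

Definition digit_series (f : nat -> R) : \bar R := (\sum_(k <oo) (over_ln (f k) * sqinv k)%:E)%E.

(** Interchanging the two sums leaves, for each [k], the number of [n] with [n ln n < m f k], which
    is of order [over_ln (f k)]. *)
Lemma digit_series_conv f m : (forall k, 1 < f k) -> (digit_series f < +oo)%E ->
  (\sum_(n <oo) sqsum (fun k => (n%:R * ln n%:R < m%:R * f k)%R%:R : R) < +oo)%E.
Proof.
move=> f1 fS.
have [->|m0] := posnP m.
  rewrite eseries0 ?ltry// => n _ _; rewrite /sqsum eseries0// => k _ _.
  rewrite mul0r ltNge mulr_ge0//=; first by rewrite mul0r.
  by have [->|n0] := posnP n; [rewrite ln0|rewrite ln_ge0// ler1n].
rewrite (sum_sqsum_pred (fun n k => (n%:R * ln n%:R < m%:R * f k)%R)).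
apply: (@le_lt_trans _ _ ((2 * m%:R + 1)%:E * digit_series f)%E); last first.
  by rewrite lte_mul_pinfty// ?lee_fin//; rewrite ltW// ltr_wpDl.
have o0 k : 0 <= over_ln (f k) by have := over_ln_ge1 (f1 k); lra.
rewrite -nneseriesZl; last by move=> k _; rewrite lee_fin mulr_ge0// sqinv_ge0.
apply: lee_nneseries => k _.
  by rewrite mule_ge0 ?lee_fin ?sqinv_ge0// nneseries_ge0// => *; rewrite lee_fin.
apply: le_trans (lee_wpmul2l _ (nlnn_count_ub (f1 k) m0)) _; first by rewrite lee_fin sqinv_ge0.
by rewrite -!EFinM lee_fin le_eqVlt; apply/orP; left; apply/eqP; ring.
Qed.

Lemma digit_series_div f m : (forall k, 3 < f k) -> (0 < m)%N -> digit_series f = +oo%E ->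
  (\sum_(n <oo) sqsum (fun k => (m%:R * (n%:R * ln n%:R) < f k)%R%:R : R) = +oo)%E.
Proof.
move=> f3 m0 fS; have m1 : 1 <= m%:R :> R by rewrite ler1n.
rewrite (sum_sqsum_pred (fun n k => (m%:R * (n%:R * ln n%:R) < f k)%R)).
apply/eqP; rewrite -leye_eq.
apply: (@le_trans _ _ ((2 * m%:R)^-1%:E * digit_series f)%E).
  by rewrite fS mulry gtr0_sg ?mul1e// invr_gt0; lra.
have o0 k : 0 <= over_ln (f k).
  by have := @over_ln_ge1 (f k); have := f3 k => h /(_ _) h'; have := h' ltac:(lra); lra.
rewrite -nneseriesZl; last by move=> k _; rewrite lee_fin mulr_ge0// sqinv_ge0.
apply: lee_nneseries => k _.
  move=> _; rewrite -EFinM lee_fin; apply: mulr_ge0; first by rewrite invr_ge0; lra.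
  by apply: mulr_ge0; [exact: o0|exact: sqinv_ge0].
apply: le_trans (lee_wpmul2l _ (nlnn_count_lb (f3 k) m0)); last by rewrite lee_fin sqinv_ge0.
by rewrite -!EFinM lee_fin le_eqVlt; apply/orP; left; apply/eqP; ring.
Qed.

End Growth.

(** * The almost sure dichotomy for digit processes *)

Section AlmostSure.
Context d (T : measurableType d) (R : realType) (mu : {measure set T -> \bar R}).
Variable a : nat -> T -> nat.
Hypothesis mu1 : mu setT = 1%E.
Hypothesis ma : forall n, measurable_fun setT (a n).
Hypothesis law : digit_law mu a.

Lemma measurable_digit_pred n (P : set nat) : measurable [set x | P (a n x)].
Proof. by have := ma n measurableT (Y := P) I; rewrite setTI. Qed.

(** For each [m], Borel-Cantelli gives [m f (a n x) <= n ln n] eventually, and [n ln n] is at most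
    48 times the digit sum; so the ratio is eventually at most [48 / m]. *)
Lemma ae_ratio_cvg0 (f : nat -> R) : (forall k, 1 < f k) -> (digit_series f < +oo)%E ->
  {ae mu, forall x, (fun n => f (a n x) / (digit_sum a n x)%:R) @ \oo --> (0 : R)}.
Proof.
move=> f1 fS.
have bc m : {ae mu, forall x, exists N, forall n, (N <= n)%N -> m%:R * f (a n x) <= n%:R * ln n%:R}.
  pose F n := [set x | n%:R * ln n%:R < m%:R * f (a n x)].
  have mF n : measurable (F n).
    exact: (measurable_digit_pred n (fun k => n%:R * ln n%:R < m%:R * f k)).
  exists (lim_sup_set F); split.
  - by apply: bigcap_measurable => // n _; apply: bigcup_measurable.
  - apply: lim_sup_set_cvg0 => //.
    apply: (@le_lt_trans _ _ (2%:E * \sum_(n <oo) sqsum (fun k => (n%:R * ln n%:R < m%:R * f k)%R%:R : R))%E).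
      rewrite -nneseriesZl; last by move=> n _; exact: sqsum_ge0.
      apply: lee_nneseries => // n _.
      exact: (digit_pred_prob mu1 ma law n (fun k => (n%:R * ln n%:R < m%:R * f k))).
    by rewrite lte_mul_pinfty// digit_series_conv.
  move=> x /= nx; apply: contrapT => nF; apply: nx.
  apply: contrapT => h; apply: nF => n _; apply: contrapT => h'; apply: h; exists n => j nj.
  by rewrite leNgt; apply/negP => Fj; apply: h'; exists j.
apply: filterS2 (ae_foralln bc) (digit_sum_lower mu1 ma law) => x hx [N0 hN0].
apply/cvgrPdist_le => e e0.
pose m := (Num.truncn (48 / e)).+1.
have me : 48 / e < m%:R by exact: truncnS_gt.
rewrite ltr_pdivrMr// in me.
have [N1 hN1] := hx m.
exists (maxn N0 N1) => // n /=; rewrite geq_max => /andP[n0 n1].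
have f0 : 0 < f (a n x) by have := f1 (a n x); lra.
rewrite sub0r normrN ger0_norm; last by rewrite divr_ge0// ltW.
have := hN0 n n0; have := hN1 n n1.
(* With digit sum 0 the quotient is 0 by convention. *)
have [->|S0] := eqVneq (digit_sum a n x) 0%N; first by move=> _ _; rewrite invr0 mulr0 ltW.
have S1 : 1 <= (digit_sum a n x)%:R :> R by rewrite ler1n lt0n.
rewrite ler_pdivrMr; last lra.
set s : R := (digit_sum a n x)%:R in S1 *; set y := f _ in f0 *; set l := n%:R * _ => h1 h2.
have m1 : 1 <= m%:R :> R by rewrite ler1n.
rewrite -(ler_pM2l (_ : 0 < m%:R)); last lra.
by nra.
Qed.

(** On [G m N] the ratio stays below [m] from [N] on. There, [f (a n x) > K n ln n] with [K > m C]
    cannot occur together with a digit sum at most [C n ln n]; hence [G m N] has measure at most any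
    [e > 0]. *)
Lemma ae_ratio_unbounded (f : nat -> R) : (forall k, 3 < f k) -> digit_series f = +oo%E ->
  {ae mu, forall x, forall m N : nat, exists n, (N <= n)%N /\
     m%:R < f (a n x) / (digit_sum a n x)%:R}.
Proof.
move=> f3 fS.
pose G m N := [set x | forall n, (N <= n)%N -> f (a n x) <= m%:R * (digit_sum a n x)%:R].
have mG m N : measurable (G m N).
  rewrite (_ : G m N = \bigcap_(n in [set n | (N <= n)%N])
     [set x | f (a n x) <= m%:R * (digit_sum a n x)%:R]).
    apply: bigcap_measurable => [|n _]; first by exists N => /=.
    rewrite (_ : [set _ | _] = [set x | f (nth 0%N (word a n.+1 x) n)
        <= m%:R * (\sum_(k <- take n (word a n.+1 x)) k)%:R]).
      exact: (measurable_word_set ma n.+1 (fun w => f (nth 0%N w n) <= m%:R * (\sum_(k <- take n w) k)%:R)).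
    apply/seteqP; split => x /=; rewrite nth_word// digit_sum_word wordS -cats1 take_size_cat ?size_mkseq//.
  by apply/seteqP; split => x /= h n; [move=> /= nN|move=> nN]; exact: h.
have G0 m N : mu (G m N) = 0%E.
  have Gf := measure_fin mu1 (mG m N); rewrite -(fineK Gf); congr EFin.
  apply/eqP; rewrite eq_le fine_ge0// andbT.
  apply/ler_addgt0Pr => e e0; rewrite add0r -lee_fin fineK//.
  have [C [N' hC]] := digit_sum_upper mu1 ma law e0.
  pose K := (m * C).+1.
  apply: (conditional_borel_cantelli mu1 ma law (N := maxn N N')
    (A := fun n k => K%:R * (n%:R * ln n%:R) < f k)
    (B := fun n w => ~~ (C%:R * (n%:R * ln n%:R) < (\sum_(k <- w) k)%:R :> R))) => //.
  - exact: digit_series_div.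
  - move=> n; rewrite geq_max => /andP[_ nN'].
    rewrite (_ : [set _ | _] = [set x | C%:R * (n%:R * ln n%:R) < (digit_sum a n x)%:R :> R]); first exact: hC.
    by apply/seteqP; split => x /=; rewrite negbK digit_sum_word.
  - move=> x Gx n; rewrite geq_max => /andP[nN _]; apply/negP => /andP[h1].
    rewrite -leNgt -digit_sum_word => h2.
    have := Gx n nN; rewrite leNgt => /negP; apply; apply: le_lt_trans h1.
    apply: (@le_trans _ _ (m%:R * (C%:R * (n%:R * ln n%:R)))); first by rewrite ler_wpM2l.
    have l0 : 0 <= n%:R * ln (n%:R : R).
      by have [->|n0] := posnP n; [rewrite mul0r|rewrite mulr_ge0// ln_ge0// ler1n].
    by rewrite mulrA -natrM ler_wpM2r// ler_nat /K.
have aeG m N : {ae mu, forall x, exists n, (N <= n)%N /\ m%:R * (digit_sum a n x)%:R < f (a n x)}.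
  exists (G m N); split => // x /= h n nN; rewrite leNgt; apply/negP => h'; apply: h.
  by exists n.
have {}aeG : {ae mu, forall x, forall m N, exists n, (N <= n)%N /\ m%:R * (digit_sum a n x)%:R < f (a n x)}.
  by apply: ae_foralln => m; apply: ae_foralln => N; exact: aeG.
apply: filterS2 aeG (digit_sum_lower mu1 ma law) => x hx [N0 hN0] m N.
(* From 2 on [n ln n] is positive, hence so is the digit sum, and one may divide by it. *)
have [n [nN fn]] := hx m (maxn 2 (maxn N N0)).
move: nN; rewrite !geq_max => /andP[n2 /andP[nN nN0]]; exists n; split => //.
have S0 : 0 < (digit_sum a n x)%:R :> R.
  have : 0 < n%:R * ln (n%:R : R) by rewrite mulr_gt0 ?ln_gt0 ?ltr1n ?ltr0n//; lia.
  by have := hN0 n nN0; lra.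
by rewrite ltr_pdivlMr.
Qed.

End AlmostSure.

(** * The integral test *)

Section Regularity.
Variables (R : realType) (g : R -> R).
Hypothesis g3 : forall t, 0 <= t -> 3 < g t.
Hypothesis g_asymp : forall eta : R -> R, equiv_at_infty eta id -> asymp (fun t => g (eta t)) g.

(** Otherwise there are [t_k >= k + 1] and [s_k] within [t_k / (k + 1)] of [t_k] with
    [g s_k > (k + 1) g t_k]. The map [eta] moving [t_k] to [s_k] and fixing all other points is
    equivalent to the identity, but [g (eta t) / g t] is unbounded. *)
Lemma regular_local : exists k : nat, forall t s, k.+1%:R <= t -> `|s - t| <= t / k.+1%:R ->
  g s <= k.+1%:R * g t.
Proof.
apply: contrapT => nreg.
have /choice[ts tsP] : forall k, exists ts : R * R, [/\ k.+1%:R <= ts.1,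
    `|ts.2 - ts.1| <= ts.1 / k.+1%:R & k.+1%:R * g ts.1 < g ts.2].
  move=> k; apply: contrapT => h; apply: nreg; exists k => t s kt st.
  by rewrite leNgt; apply/negP => gs; apply: h; exists (t, s).
pose bad t := [set k | (ts k).1 = t].
pose eta t := if pselect (bad t !=set0) is left _ then (ts (xget 0%N (bad t))).2 else t.
(* Several [t_k] may coincide, and [eta] then uses one of their indices. Beyond [M K], which
   dominates the first [K] points, any such index is at least [K]. *)
pose M K : R := \sum_(k < K) (ts k).1.
have t0 k : 0 < (ts k).1.
  by case: (tsP k) => h _ _; apply: lt_le_trans h.
have late K t : M K < t -> bad t !=set0 -> (K <= xget 0%N (bad t))%N.
  move=> Mt bt; have := xgetPex 0%N bt; set k := xget _ _; rewrite /bad /= => kt.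
  rewrite leqNgt; apply/negP => kK; move: Mt; rewrite -kt ltNge => /negP; apply.
  rewrite /M (bigD1 (Ordinal kK))//= lerDl sumr_ge0// => i _; exact/ltW/t0.
have eta_equiv : equiv_at_infty eta id.
  apply/cvgrPdist_le => e e0; pose K := (Num.truncn e^-1).+1.
  near=> t.
  have Mt : M K < t by near: t; apply: nbhs_pinfty_gt; exact: num_real.
  have t1 : 0 < t by near: t; apply: nbhs_pinfty_gt; exact: num_real.
  rewrite /eta; case: pselect => [bt|_]; last by rewrite /= divff ?gt_eqF// subrr normr0 ltW.
  have Kk := late _ _ Mt bt; have := xgetPex 0%N bt; set k := xget _ _ in Kk *.
  rewrite /bad /= => kt; have [_ h _] := tsP k; rewrite kt in h.
  rewrite -[X in X - _](@divff _ t) ?gt_eqF// -mulrBl normrM distrC normfV (gtr0_norm t1).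
  rewrite ler_pdivrMr// mulrC; apply: le_trans h _; rewrite ler_wpM2l ?(ltW t1)//.
  rewrite -[leRHS]invrK lef_pV2 ?posrE ?invr_gt0//.
  apply: (@le_trans _ _ K%:R); first exact/ltW/truncnS_gt.
  by rewrite ler_nat leqW.
have [_ _] := g_asymp eta_equiv; rewrite /limf_esup => /ereal_inf_lt [_ [V [A [_ AV]] <-]] Vlt.
set r := (fun t => _) in Vlt.
have [K rK] : exists K : nat, forall t, V t -> (r t <= K%:R%:E)%E.
  have rsup t : V t -> (r t <= ereal_sup (r @` V))%E by move=> Vt; apply: ereal_sup_ubound; exists t.
  case: (ereal_sup (r @` V)) Vlt rsup => [s| |] //.
  - move=> _ rs; exists (Num.truncn s).+1 => t Vt; apply: le_trans (rs t Vt) _.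
    by rewrite lee_fin ltW// truncnS_gt.
  - move=> _ rs; exists 0%N => t Vt; apply: le_trans (rs t Vt) _; exact: leNye.
(* Puts [t] beyond both [A], where the ratio is at most [K], and [M K], where it exceeds [K] at bad
   points. *)
pose k0 := Num.truncn (`|A| + `|M K|).
have [k0t _ _] := tsP k0; set t := (ts k0).1 in k0t.
have k0A : `|A| + `|M K| < k0.+1%:R by exact: truncnS_gt.
have bt : bad t !=set0 by exists k0.
have Vt : V t by apply: AV; have := ler_norm A; have := normr_ge0 (M K); lra.
have Mt : M K < t by have := ler_norm (M K); have := normr_ge0 A; lra.
have := rK t Vt; rewrite /r /eta; case: pselect => // ?.
have Kk := late _ _ Mt bt; have := xgetPex 0%N bt; set k := xget _ _ in Kk *.
rewrite /bad /= => kt; have [_ _ gk] := tsP k; rewrite kt in gk.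
have gt0 : 0 < g t by have := g3 (ltW (t0 k0)); rewrite -/t; lra.
rewrite lee_fin ler_pdivrMr// => h.
have : K%:R <= k.+1%:R :> R by rewrite ler_nat leqW.
nra.
Unshelve. all: by end_near.
Qed.

(** The way from [t] to [s] has length at most [3 t]; cut into [3 (k + 1)] equal steps, it needs
    that many uses of the local bound in each direction. *)
Lemma regular_dilation : exists C T : R, [/\ 1 <= C, 1 <= T & forall t s, T <= t -> t <= s <= 4 * t ->
  g s <= C * g t /\ g t <= C * g s].
Proof.
have [k kP] := regular_local; pose K : R := k.+1%:R.
have K1 : 1 <= K by rewrite ler1n.
pose m := (3 * k.+1)%N; exists (K ^+ m), K; split => //; first exact: exprn_ege1.
move=> t s Kt /andP[ts s4].
have m0 : 0 < m%:R :> R by rewrite ltr0n.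
pose dt := (s - t) / m%:R.
have dt0 : 0 <= dt by rewrite divr_ge0 ?subr_ge0// ltW.
have dtt : dt <= t / K.
  by rewrite /dt /m natrM invfM mulrA ler_wpM2r ?invr_ge0//; lra.
have H j : g (t + j%:R * dt) <= K ^+ j * g t /\ g t <= K ^+ j * g (t + j%:R * dt).
  elim: j => [|j [IH1 IH2]]; first by rewrite mul0r addr0 expr0 mul1r.
  set u := t + j%:R * dt in IH1 IH2.
  have tu : t <= u by rewrite lerDl mulr_ge0.
  have uE : t + j.+1%:R * dt = u + dt by rewrite -natr1 mulrDl mul1r addrA.
  have uK : t / K <= u / K by rewrite ler_wpM2r// invr_ge0; lra.
  have uK' : u / K <= (u + dt) / K by rewrite ler_wpM2r ?invr_ge0; lra.
  rewrite uE !exprS -!mulrA; split.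
    apply: (@le_trans _ _ (K * g u)); last by rewrite ler_wpM2l//; lra.
    apply: kP; first by rewrite -/K; lra.
    by rewrite addrAC subrr add0r ger0_norm//; apply: le_trans dtt uK.
  apply: (le_trans IH2); rewrite mulrCA ler_wpM2l ?exprn_ge0//.
  apply: kP; first by rewrite -/K; lra.
  rewrite opprD addrA subrr add0r normrN ger0_norm//.
  by apply: le_trans (le_trans dtt uK) uK'.
have := H m; rewrite /dt mulrCA divff ?gt_eqF// mulr1 addrC subrK.
by [].
Qed.

End Regularity.

Section OverLn.
Variable R : realType.

(** If [v <= u], the logarithms compare in the right direction. Otherwise [ln v <= ln u + v / u - 1]
    and [1 < 2 ln u] give [u ln v <= 3 v ln u], whence the factor 3. *)
Lemma over_ln_le (K u v : R) : 1 <= K -> 3 < u -> 3 < v -> u <= K * v ->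
  over_ln u <= 3 * K * over_ln v.
Proof.
move=> K1 u3 v3 uv; rewrite /over_ln.
have lnP x : 3 < x -> 1 < 2 * ln (x : R).
  by move=> x3; apply: lt_trans (ln3_gt R) _; rewrite ltr_pM2l// ltr_ln ?posrE//; lra.
have lu := lnP u u3; have lv := lnP v v3.
rewrite ler_pdivrMr; last lra.
rewrite mulrA mulrAC ler_pdivlMr; last lra.
have [vu|uv'] := leP v u.
  have : ln v <= ln u by rewrite ler_ln ?posrE; lra.
  move=> lvu; apply: (@le_trans _ _ (K * v * ln u)); first by apply: ler_pM; lra.
  by rewrite ler_wpM2r; [|lra|]; nra.
have lr : ln v <= ln u + (v / u - 1).
  have : ln (1 + (v / u - 1)) <= v / u - 1.
    apply: le_ln1Dx; have : 0 < v / u by apply: divr_gt0; lra.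
    lra.
  rewrite addrCA subrr addr0 ln_div ?posrE; lra.
have : u * ln v <= u * ln u + v - u.
  apply: (@le_trans _ _ (u * (ln u + (v / u - 1)))); first by rewrite ler_wpM2l//; lra.
  rewrite le_eqVlt; apply/orP; left; apply/eqP; field; rewrite gt_eqF//; lra.
have : u * ln u <= v * ln u by rewrite ler_wpM2r; lra.
have : v <= 2 * (v * ln u) by nra.
have : 3 * (v * ln u) <= 3 * K * v * ln u by rewrite -!mulrA ler_wpM2l// ler_peMl//; apply: mulr_ge0; lra.
lra.
Qed.

End OverLn.

(** * The series over primes, by blocks *)

Section Blocks.
Variables (R : realType) (u : R -> R) (C : R) (J : nat).

Hypothesis C1 : 1 <= C.
Hypothesis J5 : (5 <= J)%N.
Hypothesis u0 : forall t, 0 <= t -> 0 <= u t.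
Hypothesis u_block : forall j s, (J <= j)%N -> 4 ^+ j <= s <= 4 ^+ j.+1 ->
  u s <= C * u (4 ^+ j) /\ u (4 ^+ j) <= C * u s.

(** The common order of magnitude, on the block from [4 ^ j] to [4 ^ j.+1], of the sum over primes
    and of the integral. *)
Definition block_term j : R := u (4 ^+ j) / (j%:R * 4 ^+ j).
Definition bounded_blocks := exists M : R, forall n, \sum_(J <= j < J + n) block_term j <= M.

Let C0 : 0 <= C. Proof. exact: le_trans ler01 C1. Qed.
Let C_gt0 : 0 < C. Proof. exact: lt_le_trans ltr01 C1. Qed.
Let x0 j : 0 < 4 ^+ j :> R. Proof. by rewrite exprn_gt0. Qed.
Let ux0 j : 0 <= u (4 ^+ j). Proof. exact/u0/ltW. Qed.

Lemma sum_block_primes j (c : R) :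
  \sum_(4 ^ j <= k < 4 ^ j.+1 | prime k) c = (prime_block j)%:R * c.
Proof. by rewrite big_const_seq iter_addr_0 mulr_natl. Qed.

(** At most [4 ^ j.+1 / j] primes, each contributing at most [C u (4 ^ j) / 16 ^ j]. *)
Lemma block_primes_le j : (J <= j)%N ->
  \sum_(4 ^ j <= k < 4 ^ j.+1 | prime k) u k%:R * sqinv k <= 4 * C * block_term j.
Proof.
move=> Jj; have j0 : (0 < j)%N by lia.
have j1 : 1 <= j%:R :> R by rewrite ler1n.
apply: (@le_trans _ _ (\sum_(4 ^ j <= k < 4 ^ j.+1 | prime k) C * u (4 ^+ j) / (4 ^+ j) ^+ 2)).
  rewrite big_nat_cond [leRHS]big_nat_cond; apply: ler_sum => k /andP[/andP[k1 k2] _].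
  have k1R : 4 ^+ j <= k%:R :> R by rewrite -natrX ler_nat.
  have k2R : k%:R <= 4 ^+ j.+1 :> R by rewrite -natrX ler_nat ltnW.
  have [h _] := u_block Jj (introT andP (conj k1R k2R)).
  have xj := x0 j.
  apply: ler_pM => //; [by apply: u0|exact: sqinv_ge0|].
  rewrite /sqinv lef_pV2 ?posrE ?exprn_gt0//; last lra.
  by rewrite ler_pXn2r// nnegrE ltW//; lra.
rewrite sum_block_primes /block_term.
have := prime_block_le j; rewrite -(ler_nat R) natrM natrX exprS.
have := x0 j; have := ux0 j; set x := 4 ^+ j; set U := u x; set p : R := (prime_block j)%:R.
move=> U0 x0' h.
rewrite [leLHS](_ : _ = (C * U / (j%:R * x ^+ 2)) * (j%:R * p)); last by field; rewrite !gt_eqF//; lra.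
rewrite [leRHS](_ : _ = (C * U / (j%:R * x ^+ 2)) * (4 * x)); last by field; rewrite !gt_eqF//; lra.
rewrite ler_wpM2l//; apply: divr_ge0; apply: mulr_ge0 => //.
by rewrite exprn_ge0// ltW.
Qed.

(** At least [4 ^ j / (4 j)] primes, each contributing at least [u (4 ^ j) / (16 C)] divided by
    [16 ^ j]; hence [64 = 4 * 16]. *)
Lemma block_primes_ge j : (J <= j)%N ->
  block_term j <= 64 * C * \sum_(4 ^ j <= k < 4 ^ j.+1 | prime k) u k%:R * sqinv k.
Proof.
move=> Jj; have j0 : (0 < j)%N by lia.
have j1 : 1 <= j%:R :> R by rewrite ler1n.
have xj := x0 j.
apply: (@le_trans _ _ (64 * C * \sum_(4 ^ j <= k < 4 ^ j.+1 | prime k) u (4 ^+ j) / C / (4 * 4 ^+ j) ^+ 2)); last first.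
  rewrite ler_wpM2l ?mulr_ge0//.
  rewrite big_nat_cond [leRHS]big_nat_cond; apply: ler_sum => k /andP[/andP[k1 k2] _].
  have k1R : 4 ^+ j <= k%:R :> R by rewrite -natrX ler_nat.
  have k2R : k%:R <= 4 ^+ j.+1 :> R by rewrite -natrX ler_nat ltnW.
  have [_ h] := u_block Jj (introT andP (conj k1R k2R)).
  apply: ler_pM.
  - by rewrite divr_ge0//; lra.
  - by rewrite invr_ge0 exprn_ge0//; lra.
  - by rewrite ler_pdivrMr ?(lt_le_trans ltr01 C1)// mulrC.
  rewrite /sqinv lef_pV2 ?posrE ?exprn_gt0//; try lra.
  by rewrite ler_pXn2r// ?nnegrE -?exprS//; lra.
rewrite sum_block_primes /block_term.
have : (4 ^ j <= 4 * j * prime_block j)%N by have := prime_block_ge (leq_trans J5 Jj); nia.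
rewrite -(ler_nat R) !natrM natrX.
have := ux0 j; set x := 4 ^+ j in xj *; set U := u x; set p : R := (prime_block j)%:R.
move=> U0 h2.
rewrite [leLHS](_ : _ = (U / (j%:R * x ^+ 2)) * x); last by field; rewrite !gt_eqF//; lra.
rewrite [leRHS](_ : _ = (U / (j%:R * x ^+ 2)) * (4 * j%:R * p)); last by field; rewrite !gt_eqF//; lra.
rewrite ler_wpM2l//; apply: divr_ge0; first by [].
by apply: mulr_ge0 => //; rewrite exprn_ge0// ltW.
Qed.

Definition prime_part k : nat := if prime k then k else 0%N.
Definition prime_series : \bar R := (\sum_(k <oo) (u (prime_part k)%:R * sqinv k)%:E)%E.

Let v k : R := u (prime_part k)%:R * sqinv k.
Let v0 k : 0 <= v k. Proof. by rewrite mulr_ge0 ?sqinv_ge0// u0. Qed.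

Lemma sum_pow4_blocks (F : nat -> R) (P : pred nat) n :
  \sum_(4 ^ J <= k < 4 ^ (J + n) | P k) F k =
  \sum_(J <= j < J + n) \sum_(4 ^ j <= k < 4 ^ j.+1 | P k) F k.
Proof.
elim: n => [|n IH]; first by rewrite addn0 !big_geq.
rewrite addnS [RHS]big_nat_recr ?leq_addr//= -IH.
by rewrite (big_cat_nat (n := 4 ^ (J + n)))//= leq_exp2l ?leq_addr.
Qed.

(** Beyond the finitely many terms below [4 ^ J], nonprime [k] contribute [u 0 / k ^ 2], at most
    [2 u 0] in total, and the primes are summed by blocks. *)
Lemma prime_series_lty : bounded_blocks -> (prime_series < +oo)%E.
Proof.
move=> [M hM].
apply: (@le_lt_trans _ _ (\sum_(0 <= k < 4 ^ J) v k + (2 * u 0 + 4 * C * M))%:E); last exact: ltry.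
apply: nneseries_le_bound => [k|n]; first by rewrite lee_fin; exact: v0.
rewrite sumEFin lee_fin.
have nJ : (n <= 4 ^ (J + n))%N by apply: leq_trans (ltnW (ltn_expl n (isT : 1 < 4)%N)) _; rewrite leq_exp2l ?leq_addl.
apply: (@le_trans _ _ (\sum_(0 <= k < 4 ^ (J + n)) v k)).
  by rewrite [leRHS](big_cat_nat (n := n))//= lerDl sumr_ge0.
have JJ : (4 ^ J <= 4 ^ (J + n))%N by rewrite leq_exp2l ?leq_addr.
rewrite (big_cat_nat (n := 4 ^ J))//= lerD2l.
rewrite (bigID prime) /= addrC; apply: lerD.
  apply: (@le_trans _ _ (\sum_(0 <= k < 4 ^ (J + n)) u 0 * sqinv k)).
    rewrite [leRHS](big_cat_nat (n := 4 ^ J))//= [X in _ <= _ + X](bigID prime)/=.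
    rewrite [leLHS](eq_bigr (fun k => u 0 * sqinv k)); last by move=> k /negbTE kp; rewrite /v /prime_part kp.
    have s0 k : 0 <= u 0 * sqinv k by rewrite mulr_ge0 ?sqinv_ge0// u0.
    by rewrite addrA lerDr addr_ge0// sumr_ge0.
  by rewrite -mulr_sumr mulrC ler_wpM2r ?u0// sum_sqinv_le2.
rewrite (eq_bigr (fun k => u k%:R * sqinv k)); last by move=> k kp; rewrite /v /prime_part kp.
rewrite sum_pow4_blocks; apply: (@le_trans _ _ (\sum_(J <= j < J + n) 4 * C * block_term j)).
  rewrite big_nat_cond [leRHS]big_nat_cond; apply: ler_sum => j /andP[/andP[Jj _] _].
  exact: block_primes_le.
by rewrite -mulr_sumr ler_wpM2l ?mulr_ge0.
Qed.

Lemma prime_series_bounded : (prime_series < +oo)%E -> bounded_blocks.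
Proof.
move=> pS; have p0 : (0 <= prime_series)%E by apply: nneseries_ge0 => k _ _; rewrite lee_fin; exact: v0.
have pf : prime_series \is a fin_num by rewrite ge0_fin_numE.
exists (64 * C * fine prime_series) => n.
apply: (@le_trans _ _ (\sum_(J <= j < J + n) 64 * C * \sum_(4 ^ j <= k < 4 ^ j.+1 | prime k) u k%:R * sqinv k)).
  rewrite big_nat_cond [leRHS]big_nat_cond; apply: ler_sum => j /andP[/andP[Jj _] _].
  exact: block_primes_ge.
rewrite -mulr_sumr -sum_pow4_blocks ler_wpM2l ?mulr_ge0//.
rewrite -lee_fin fineK//; apply: le_trans (sum_le_nneseries (4 ^ (J + n)) _); last by move=> k; rewrite lee_fin; exact: v0.
rewrite sumEFin lee_fin.
apply: (@le_trans _ _ (\sum_(4 ^ J <= k < 4 ^ (J + n)) v k)).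
  rewrite [leRHS](bigID prime)/= (eq_bigr v); last by move=> k kp; rewrite /v /prime_part kp.
  by rewrite lerDl sumr_ge0.
rewrite [leRHS](big_cat_nat (n := 4 ^ J))//= ?leq_exp2l ?leq_addr//.
by rewrite lerDr sumr_ge0// => k _; exact: v0.
Qed.

End Blocks.

(** * The integral, by the same blocks *)

Section BlockIntegrals.
Variables (R : realType) (u : R -> R) (C : R) (J : nat).

Hypothesis C1 : 1 <= C.
Hypothesis J5 : (5 <= J)%N.
Hypothesis u0 : forall t, 0 <= t -> 0 <= u t.
Hypothesis u_block : forall j s, (J <= j)%N -> 4 ^+ j <= s <= 4 ^+ j.+1 ->
  u s <= C * u (4 ^+ j) /\ u (4 ^+ j) <= C * u s.
Hypothesis mu : measurable_fun (`[0, +oo[ : set R) u.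

Local Notation integrand := (fun y : R => (u y / (y ^+ 2 * ln y))%:E).
Local Notation block j := (`[4 ^+ j, 4 ^+ j.+1[%classic : set R).
Local Notation tail j := (`[4 ^+ j, +oo[%classic : set R).
Local Notation leb := (@lebesgue_measure R).

Let C_gt0 : 0 < C. Proof. exact: lt_le_trans ltr01 C1. Qed.

Lemma measurable_integrand (D : set R) : measurable D -> D `<=` `[0, +oo[%classic ->
  measurable_fun D integrand.
Proof.
move=> mD D0; apply/measurable_EFinP; apply: measurable_funM.
  by apply: measurable_funS mu.
apply: measurable_funTS; apply: (measurableT_comp (@measurable_invr R)).
by apply: measurable_funM; [exact: measurable_funX|exact: measurable_ln].
Qed.

Lemma integrand_ge0 y : 1 <= y -> (0 <= integrand y)%E.
Proof.
move=> y1; rewrite lee_fin divr_ge0 ?u0 ?mulr_ge0 ?exprn_ge0 ?ln_ge0//; exact: le_trans ler01 y1.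
Qed.

Lemma ln4_bounds : 1 <= ln (4 : R) <= 3.
Proof.
apply/andP; split; last first.
  by have := @le_ln1Dx R 3 ltac:(lra); rewrite (_ : 1 + 3 = 4); [|ring].
have /andP[h _] := @ln_ratio R 1 isT; rewrite ln1 in h.
have -> : 4 = 2 * 2 :> R by ring.
by rewrite lnM ?posrE//; lra.
Qed.

(** On the block [y ^ 2] lies between [x ^ 2] and [16 x ^ 2], and [ln y] between [j] and [6 j],
    since [ln 4] lies between 1 and 3. *)
Lemma block_bounds j y : (J <= j)%N -> 4 ^+ j <= y < 4 ^+ j.+1 ->
  let x := 4 ^+ j : R in
  (u x / C) / (16 * x ^+ 2 * (3 * (2 * j%:R))) <= u y / (y ^+ 2 * ln y) /\
  u y / (y ^+ 2 * ln y) <= (C * u x) / (x ^+ 2 * j%:R).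
Proof.
move=> Jj /andP[xy yx] x; have j1 : 1 <= j%:R :> R by rewrite ler1n; lia.
have x1 : 1 <= x by rewrite exprn_ege1// ler1n.
have [h1 h2] := u_block Jj (introT andP (conj xy (ltW yx))).
rewrite -/x in h1 h2 xy; rewrite exprS -/x in yx.
have /andP[l1 l3] := ln4_bounds.
have y0 : 0 < y by lra.
have lx : ln x = ln 4 * j%:R by rewrite lnXn// mulr_natr.
have ly1 : j%:R <= ln y.
  apply: (@le_trans _ _ (ln x)); first by rewrite lx; nra.
  by rewrite ler_ln ?posrE//; lra.
have ly2 : ln y <= 3 * (2 * j%:R).
  apply: (@le_trans _ _ (ln (4 * x))); first by rewrite ler_ln ?posrE//; lra.
  rewrite lnM ?posrE//; last lra.
  by rewrite lx; nra.
have ux : 0 <= u x by apply: u0; lra.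
have uy : 0 <= u y by apply: u0; lra.
have xx : x ^+ 2 <= y ^+ 2 by rewrite ler_pXn2r// nnegrE; lra.
have yy : y ^+ 2 <= 16 * x ^+ 2.
  have -> : 16 * x ^+ 2 = (4 * x) ^+ 2 by ring.
  by rewrite ler_pXn2r// ?nnegrE; lra.
have x20 : 0 < x ^+ 2 by rewrite exprn_gt0//; lra.
split; apply: ler_pM => //.
- by rewrite divr_ge0// ltW.
- by rewrite invr_ge0 !mulr_ge0 ?exprn_ge0//; lra.
- by rewrite ler_pdivrMr// mulrC.
- rewrite lef_pV2 ?posrE; [by apply: ler_pM => //; lra|by rewrite !mulr_gt0//; lra|by rewrite mulr_gt0//; lra].
- by rewrite invr_ge0 mulr_ge0//; lra.
- rewrite lef_pV2 ?posrE; [by apply: ler_pM => //; lra|by rewrite mulr_gt0//; lra|by rewrite mulr_gt0//; lra].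
Qed.

Lemma lebesgue_block j : leb (block j) = (3 * 4 ^+ j)%:E.
Proof.
rewrite lebesgue_measure_itv/= lte_fin exprS ifT; last by rewrite ltr_pMl ?exprn_gt0// ltr1n.
by rewrite -EFinB; congr EFin; ring.
Qed.

(** The pointwise bounds times the length [3 x] of the block; below, this even gives the constant
    [3 / 96 = 1 / 32]. *)
Lemma block_integral j : (J <= j)%N ->
  ((block_term u j / (64 * C))%:E <= \int[leb]_(y in block j) integrand y /\
   \int[leb]_(y in block j) integrand y <= (3 * C * block_term u j)%:E)%E.
Proof.
move=> Jj; have j1 : 1 <= j%:R :> R by rewrite ler1n; lia.
pose x := 4 ^+ j : R; have x0 : 0 < x by rewrite exprn_gt0.
have x1 : 1 <= x by rewrite exprn_ege1// ler1n.
have ux : 0 <= u x by apply: u0; lra.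
have mI : measurable_fun (block j) integrand.
  apply: measurable_integrand => // y /=; rewrite !in_itv/= andbT => /andP[+ _].
  by rewrite -/x; lra.
have B0 y : block j y -> (0 <= integrand y)%E.
  by rewrite /= in_itv/= => /andP[xy _]; apply: integrand_ge0; rewrite -/x in xy; lra.
have K1 : 0 <= (u x / C) / (16 * x ^+ 2 * (3 * (2 * j%:R))).
  by rewrite !divr_ge0 ?mulr_ge0 ?exprn_ge0 ?(ltW C_gt0) ?(ltW x0).
have K2 : 0 <= (C * u x) / (x ^+ 2 * j%:R).
  by rewrite divr_ge0 ?mulr_ge0 ?exprn_ge0 ?(ltW C_gt0) ?(ltW x0).
split.
- apply: (@le_trans _ _ (\int[leb]_(y in block j) ((u x / C) / (16 * x ^+ 2 * (3 * (2 * j%:R))))%:E)%E).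
    rewrite integral_cst// [X in (_ <= _ * X)%E]lebesgue_block -EFinM lee_fin /block_term -/x.
    rewrite [leRHS](_ : _ = 2 * (u x / (j%:R * x) / (64 * C))).
      have : 0 <= u x / (j%:R * x) / (64 * C) by rewrite !divr_ge0 ?mulr_ge0 ?(ltW C_gt0) ?(ltW x0).
      lra.
    by field; rewrite !gt_eqF//; lra.
  apply: ge0_le_integral => // y /=; rewrite in_itv/= => yb; rewrite lee_fin.
  by have [] := block_bounds Jj yb.
- apply: (@le_trans _ _ (\int[leb]_(y in block j) ((C * u x) / (x ^+ 2 * j%:R))%:E)%E).
    apply: ge0_le_integral => // y /=; rewrite in_itv/= => yb; rewrite lee_fin.
    by have [] := block_bounds Jj yb.
  rewrite integral_cst// [X in (_ * X <= _)%E]lebesgue_block -EFinM lee_fin /block_term -/x.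
  rewrite le_eqVlt; apply/orP; left; apply/eqP.
  by field; rewrite !gt_eqF//; lra.
Qed.

Lemma pow4_block (y : R) : 1 <= y -> exists j, 4 ^+ j <= y < 4 ^+ j.+1.
Proof.
move=> y1; have y0 : 0 <= y by lra.
have n0 : (0 < Num.truncn y)%N by rewrite truncn_gt0.
exists (trunc_log 4 (Num.truncn y)); rewrite -!natrX.
rewrite -truncn_ge_nat// -truncn_lt_nat//.
by rewrite trunc_logP// trunc_log_ltn.
Qed.

Lemma integral_blocks :
  (\int[leb]_(y in tail J) integrand y =
   \sum_(j <oo) \int[leb]_(y in block (J + j)) integrand y)%E.
Proof.
have le4 i j : (4 ^+ i <= 4 ^+ j :> R) = (i <= j)%N by rewrite ler_eXn2l// ltr1n.
have x1 i : 1 <= 4 ^+ i :> R by rewrite exprn_ege1// ler1n.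
have E : `[4 ^+ J, +oo[%classic = \bigcup_j block (J + j) :> set R.
  apply/seteqP; split => y /=; rewrite ?in_itv/= ?andbT.
    move=> Jy; have [j /andP[jy yj]] := pow4_block (le_trans (x1 J) Jy).
    have Jj : (J <= j)%N.
      by have := le_lt_trans Jy yj; rewrite ltNge le4 -ltnNge ltnS.
    by exists (j - J)%N => //=; rewrite in_itv/= subnKC// jy.
  move=> [j _ /=]; rewrite in_itv/= => /andP[jy _]; apply: le_trans jy.
  by rewrite le4 leq_addr.
rewrite E ge0_integral_bigcup//.
- rewrite -E; apply: measurable_integrand => // y /=; rewrite !in_itv/= !andbT.
  by apply: le_trans; exact: le_trans ler01 (x1 J).
- move=> y [j _ /=]; rewrite in_itv/= => /andP[jy _].
  by apply: integrand_ge0; exact: le_trans (x1 _) jy.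
- apply/trivIsetP => i j _ _ ij; apply/seteqP; split => // y [/=].
  rewrite !in_itv/= => /andP[i1 i2] /andP[j1 j2].
  have := le_lt_trans i1 j2; rewrite ltNge le4 -ltnNge => ij'.
  have := le_lt_trans j1 i2; rewrite ltNge le4 -ltnNge => ji'.
  by move: ij; apply/negP; rewrite negbK; apply/eqP; lia.
Qed.

Lemma sum_block_shift (F : nat -> R) n :
  \sum_(J <= j < J + n) F j = \sum_(0 <= j < n) F (J + j)%N.
Proof. by rewrite -{1}[J]add0n big_addn addKn; apply: eq_bigr => j _; rewrite addnC. Qed.

Lemma integral_lty : bounded_blocks u J ->
  (\int[leb]_(y in tail J) integrand y < +oo)%E.
Proof.
move=> [M hM]; rewrite integral_blocks.
apply: (@le_lt_trans _ _ (3 * C * M)%:E); last exact: ltry.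
have B0 j : (0 <= \int[leb]_(y in block (J + j)) integrand y)%E.
  apply: integral_ge0 => y /=; rewrite in_itv/= => /andP[jy _].
  by apply: integrand_ge0; apply: le_trans jy; rewrite exprn_ege1// ler1n.
apply: nneseries_le_bound => // n.
apply: (@le_trans _ _ (\sum_(0 <= j < n) (3 * C * block_term u (J + j))%:E)%E).
  by apply: lee_sum => j _; have [] := block_integral (leq_addr j J).
rewrite sumEFin lee_fin -mulr_sumr -sum_block_shift.
by rewrite ler_wpM2l ?mulr_ge0// ltW.
Qed.

Lemma integral_bounded_blocks :
  (\int[leb]_(y in tail J) integrand y < +oo)%E -> bounded_blocks u J.
Proof.
rewrite integral_blocks; set I := (\sum_(j <oo) _)%E => Ioo.
have B0 j : (0 <= \int[leb]_(y in block (J + j)) integrand y)%E.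
  apply: integral_ge0 => y /=; rewrite in_itv/= => /andP[jy _].
  by apply: integrand_ge0; apply: le_trans jy; rewrite exprn_ege1// ler1n.
have If : I \is a fin_num by rewrite ge0_fin_numE// nneseries_ge0.
exists (64 * C * fine I) => n.
have C64 : 0 < 64 * C by rewrite mulr_gt0.
rewrite sum_block_shift mulrC -ler_pdivrMr// mulr_suml -lee_fin fineK//.
apply: le_trans (sum_le_nneseries n B0).
by rewrite -sumEFin; apply: lee_sum => j _; have [] := block_integral (leq_addr j J).
Qed.

End BlockIntegrals.

(** * Prime digits *)

Section ContinuedFractions.
Variable R : realType.
Local Notation leb := (@lebesgue_measure R).

Let measurable_unit : measurable (`]0, 1]%classic : set R). Proof. exact: measurable_itv. Qed.
Let unit_measure := mrestr leb measurable_unit.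
(** The shift makes [digit_sum a n] the sum of exactly the digits preceding [a n]. *)
Let a n (x : R) := cf_digit n.+1 x.

Let lebesgue_unit : leb (`]0, 1]%classic : set R) = 1%E.
Proof.
have -> := lebesgue_measure_itv (`]0, 1] : interval R).
by rewrite /= lte_fin ltr01 oppr0 adde0.
Qed.

Let unit_measure1 : unit_measure setT = 1%E.
Proof. by rewrite /unit_measure /mrestr setTI; exact: lebesgue_unit. Qed.

Let measurable_a n : measurable_fun setT (a n).
Proof. exact: measurable_cf_digit. Qed.

Let law_a : digit_law unit_measure a.
Proof.
move=> n w k sw /=; rewrite /unit_measure /mrestr.
have -> : [set x | word a n x = w] `&` a n @^-1` [set k] `&` `]0, 1] =
   cylinder n w `&` (cf_digit n.+1 @^-1` [set k]) by rewrite /cylinder setIC setIA.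
have -> : [set x | word a n x = w] `&` `]0, 1] = cylinder n w by rewrite /cylinder setIC.
exact: (measure_cylinder_digit R k sw).
Qed.

Let ae_unit (P : R -> Prop) : {ae unit_measure, forall x, P x} ->
  {ae leb, forall x, x \in `]0, 1] -> P x}.
Proof.
move=> [N [mN N0 PN]]; exists (N `&` `]0, 1]%classic); split => //.
  exact: measurableI.
move=> x /= /not_implyP[x01 Px]; split => //; exact: PN.
Qed.

(** The unit interval, of measure 1, would be covered by two null sets. *)
Lemma ae_unit_inconsistent (P Q : R -> Prop) :
  {ae leb, forall x, x \in `]0, 1] -> P x} -> {ae leb, forall x, x \in `]0, 1] -> Q x} ->
  (forall x, P x -> Q x -> False) -> False.
Proof.
move=> aeP aeQ PQ.
have : leb.-negligible (`]0, 1]%classic : set R).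
  apply: negligibleS (negligibleU aeP aeQ) => x x01.
  have [Px|nPx] := pselect (P x); [right|left] => /= h; last exact: nPx (h x01).
  exact: PQ Px (h x01).
move/negligibleP => /(_ measurable_unit) h.
by have /eqP := etrans (esym lebesgue_unit) h; rewrite onee_eq0.
Qed.

Let cf_partial_sumS n (x : R) : cf_partial_sum n.+1 x = (digit_sum a n x)%:R.
Proof. by rewrite /cf_partial_sum /digit_sum big_add1. Qed.

Section Dichotomy.
Variable g : R -> R.
Let f k : R := g (prime_part k)%:R.

Lemma ae_prime_ratio_cvg0 : (forall k, 1 < f k) -> (digit_series f < +oo)%E ->
  {ae leb, forall x, x \in `]0, 1] ->
    (fun n => g (cf_prime_digit n x)%:R / cf_partial_sum n x) @ \oo --> (0 : R)}.
Proof.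
move=> f1 fS; apply: ae_unit.
apply: filterS (ae_ratio_cvg0 unit_measure1 measurable_a law_a f1 fS) => x.
by rewrite -[X in _ -> X]cvg_shiftS; under eq_fun do rewrite -cf_partial_sumS.
Qed.

Lemma ae_prime_ratio_limsup : (forall k, 3 < f k) -> digit_series f = +oo%E ->
  {ae leb, forall x, x \in `]0, 1] ->
    limn_esup (fun n => ((g (cf_prime_digit n x)%:R / cf_partial_sum n x)%:E : \bar R)) = +oo%E}.
Proof.
move=> f3 fS; apply: ae_unit.
apply: filterS (ae_ratio_unbounded unit_measure1 measurable_a law_a f3 fS) => x hx.
(* The upper limit is an infimum of suprema over neighbourhoods of infinity; each supremum exceeds
   every [M]. *)
apply/eqP; rewrite -leye_eq; apply: le_ereal_inf_tmp => _ [V [N _ NV] <-].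
rewrite leye_eq; apply/eqP/eqyP => M M0.
have [n [Nn hn]] := hx (Num.truncn M).+1 N.
apply: (@le_trans _ _ (g (cf_prime_digit n.+1 x)%:R / cf_partial_sum n.+1 x)%:E); last first.
  by apply: ereal_sup_ubound; exists n.+1 => //; apply: NV; exact: leqW.
rewrite lee_fin cf_partial_sumS; apply/ltW/(lt_trans _ hn)/truncnS_gt.
Qed.

End Dichotomy.

End ContinuedFractions.

Lemma limn_esup_EFin_cvg0 (R : realType) (r : nat -> R) :
  r @ \oo --> (0 : R) -> limn_esup (fun n => (r n)%:E) = 0%E.
Proof.
move=> r0; have h : (fun n => (r n)%:E) @ \oo --> (0 : R)%:E.
  by apply: cvg_EFin => //; apply: nearW.
by rewrite is_cvg_limn_esupE ?(cvg_lim _ h)//; apply/cvg_ex; exists 0%E.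
Qed.

(** * The integral test for [g] and the conclusion *)

Section PrimeDigitSeries.
Variables (R : realType) (g : R -> R).
Hypothesis g3 : forall t, 0 <= t -> 3 < g t.

Lemma over_ln_g_ge0 t : 0 <= t -> 0 <= over_ln (g t).
Proof.
by move=> /g3 gt; apply: le_trans ler01 (over_ln_ge1 _); lra.
Qed.

Lemma over_ln_g_block (K : R) J : 1 <= K ->
  (forall j s, (J <= j)%N -> 4 ^+ j <= s <= 4 ^+ j.+1 ->
     g s <= K * g (4 ^+ j) /\ g (4 ^+ j) <= K * g s) ->
  forall j s, (J <= j)%N -> 4 ^+ j <= s <= 4 ^+ j.+1 ->
     over_ln (g s) <= 3 * K * over_ln (g (4 ^+ j)) /\
     over_ln (g (4 ^+ j)) <= 3 * K * over_ln (g s).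
Proof.
move=> K1 gK j s Jj sj; have x0 : 0 <= 4 ^+ j :> R by rewrite exprn_ge0.
have s0 : 0 <= s by case/andP: sj => h _; exact: le_trans h.
have [h1 h2] := gK j s Jj sj.
by split; apply: over_ln_le => //; exact: g3.
Qed.

End PrimeDigitSeries.

(** With [x = 4 ^ j], [x + 4 <= 2 x] and [ln (x + 4) >= j] bound the block terms by [2 / j ^ 2]. The
    shift by 4 keeps the function above 3 at digit 0. *)
Lemma prime_series_add4 (R : realType) : (prime_series (fun t : R => over_ln (t + 4)) < +oo)%E.
Proof.
have g3 (t : R) : 0 <= t -> 3 < t + 4 by lra.
apply: (@prime_series_lty R _ (3 * 4) 5); [lra|by []|exact: over_ln_g_ge0| |].
  apply: (@over_ln_g_block _ (fun t => t + 4)) => //; first by lra.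
  move=> j s _; have : 0 < 4 ^+ j :> R by rewrite exprn_gt0.
  by rewrite exprS => x0 /andP[h1 h2]; split; lra.
exists 4 => n; apply: (@le_trans _ _ (\sum_(5 <= j < 5 + n) 2 * sqinv j)); last first.
  rewrite -mulr_sumr (_ : 4 = 2 * 2 :> R); last by ring.
  rewrite ler_pM2l//; apply: le_trans (sum_sqinv_le2 R (5 + n)).
  by rewrite [leRHS](big_cat_nat (n := 5))//= lerDr sumr_ge0// => k _; exact: sqinv_ge0.
rewrite big_nat_cond [leRHS]big_nat_cond; apply: ler_sum => j /andP[/andP[j5 _] _].
have j1 : 1 <= j%:R :> R by rewrite ler1n; lia.
rewrite /block_term /over_ln /sqinv; set x := 4 ^+ j : R.
have x4 : 4 <= x by rewrite -[leLHS]expr1 ler_eXn2l// ?ltr1n//; lia.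
have /andP[l4 _] := ln4_bounds R.
have lx : j%:R <= ln (x + 4).
  apply: (@le_trans _ _ (ln x)); last by rewrite ler_ln ?posrE; lra.
  by rewrite /x lnXn// -mulr_natr; nra.
have jx : 0 < j%:R * x by rewrite mulr_gt0; lra.
rewrite ler_pdivrMr// ler_pdivrMr; last lra.
rewrite [leRHS](_ : _ = 2 * x * (ln (x + 4) / j%:R)); last by field; rewrite gt_eqF; lra.
have : 1 <= ln (x + 4) / j%:R by rewrite ler_pdivlMr ?mul1r; lra.
nra.
Qed.

Theorem theorem2p8 (R : realType) :
  (* first statement *)
  {ae (@lebesgue_measure R), forall x, x \in `]0, 1] ->
     (fun n => (cf_prime_digit n x)%:R / cf_partial_sum n x) @ \oo --> (0 : R)}
  /\
  (* general statement *)
  (forall g : R -> R,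
     measurable_fun (`[0%R, +oo[ : set R) g ->
     (forall t, 0 <= t -> 3 < g t) ->
     (forall eta : R -> R, equiv_at_infty eta id ->
        asymp (fun t => g (eta t)) g) ->
     let I := fun c : R =>
       (\int[(@lebesgue_measure R)]_(y in `[c, +oo[)
          ((g y / ln (g y)) / (y ^+ 2 * ln y))%:E)%E in
     exists c0 : R, 1 < c0 /\ forall c : R, c0 <= c ->
       ({ae (@lebesgue_measure R), forall x, x \in `]0, 1] ->
          limn_esup (fun n => ((g (cf_prime_digit n x)%:R
                                  / cf_partial_sum n x)%:E : \bar R)) = +oo%E}
        <-> I c = +oo%E)
       /\
       ((I c < +oo)%E ->
        {ae (@lebesgue_measure R), forall x, x \in `]0, 1] ->
          (fun n => g (cf_prime_digit n x)%:R / cf_partial_sum n x)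
             @ \oo --> (0 : R)})).
Proof.
split.
  (* The first statement: the ratio lies between 0 and the ratio formed with [t + 4], which tends to
     0. *)
  have g1 t : 0 <= t -> 3 < t + 4 :> R by lra.
  have fS : (digit_series (fun k => ((prime_part k)%:R + 4 : R)%R) < +oo)%E by exact: prime_series_add4.
  have f1 k : 1 < (prime_part k)%:R + 4 :> R by have := g1 _ (ler0n R (prime_part k)); lra.
  apply: negligibleS (@ae_prime_ratio_cvg0 R (fun t => t + 4) f1 fS) => x /= nx hx; apply: nx => x01.
  have S0 n : 0 <= (cf_partial_sum n x)^-1 by rewrite invr_ge0.
  apply: (squeeze_cvgr _ (cvg_cst 0) (hx x01)).
  apply: nearW => n; rewrite mulr_ge0//= ler_wpM2r//; lra.
move=> g mg g3 g_asymp I.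
have [K [T [K1 T1 gK]]] := regular_dilation g3 g_asymp.
(* From [4 ^ J0] on both the prime counts and the comparability of [g] are available; it serves as
   [c0]. *)
pose J0 := maxn 5 (Num.truncn T).+1.
have J5 : (5 <= J0)%N by rewrite leq_maxl.
have TJ : T <= 4 ^+ J0.
  have : T < (Num.truncn T).+1%:R by exact: truncnS_gt.
  have : (Num.truncn T).+1%:R <= J0%:R :> R by rewrite ler_nat leq_maxr.
  have : J0%:R <= 4 ^+ J0 :> R by rewrite -natrX ler_nat ltnW// ltn_expl.
  lra.
pose u t := over_ln (g t).
have u0 : forall t, 0 <= t -> 0 <= u t := over_ln_g_ge0 g3.
have mu : measurable_fun (`[0%R, +oo[ : set R) u.
  apply: measurable_funM => //; apply: (measurableT_comp (@measurable_invr R)).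
  by apply: (measurableT_comp (@measurable_ln R)).
have C1 : 1 <= 3 * K by lra.
have u_block J : (J0 <= J)%N -> forall j s, (J <= j)%N -> 4 ^+ j <= s <= 4 ^+ j.+1 ->
    u s <= 3 * K * u (4 ^+ j) /\ u (4 ^+ j) <= 3 * K * u s.
  move=> JJ; apply: over_ln_g_block => // j s Jj; rewrite exprS => sj.
  apply: gK => //; apply: le_trans TJ _.
  by rewrite ler_eXn2l ?ltr1n// (leq_trans JJ).
have x1 j : 1 <= 4 ^+ j :> R by rewrite exprn_ege1// ler1n.
have I_mono c c' : 1 <= c -> c <= c' -> (I c' <= I c)%E.
  move=> c1 cc'; apply: ge0_subset_integral => //.
  - apply: (measurable_integrand mu) => // y /=; rewrite !in_itv/= !andbT; lra.
  - move=> y /=; rewrite in_itv/= andbT => cy; apply: (integrand_ge0 u0); lra.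
  - by move=> y /=; rewrite !in_itv/= !andbT; lra.
have fin c : 4 ^+ J0 <= c -> (I c < +oo)%E -> (prime_series u < +oo)%E.
  (* The blocks start beyond [c], so that their integral is part of [I c]. *)
  move=> Jc Ic; pose J := maxn J0 (Num.truncn c).+1.
  have JJ : (J0 <= J)%N by rewrite leq_maxl.
  have J5' := leq_trans J5 JJ.
  have cJ : c <= 4 ^+ J.
    have : c < (Num.truncn c).+1%:R by exact: truncnS_gt.
    have : (Num.truncn c).+1%:R <= J%:R :> R by rewrite ler_nat leq_maxr.
    have : J%:R <= 4 ^+ J :> R by rewrite -natrX ler_nat ltnW// ltn_expl.
    lra.
  apply: (prime_series_lty C1 J5' u0 (u_block J JJ)).
  apply: (integral_bounded_blocks C1 J5' u0 (u_block J JJ) mu).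
  by apply: le_lt_trans Ic; apply: I_mono => //; exact: le_trans (x1 J0) Jc.
have inf c : 4 ^+ J0 <= c -> I c = +oo%E -> prime_series u = +oo%E.
  move=> Jc Ic; apply/eqP; rewrite -leye_eq leNgt; apply/negP => pS.
  have := integral_lty C1 J5 u0 (u_block J0 (leqnn _)) mu
    (prime_series_bounded C1 J5 u0 (u_block J0 (leqnn _)) pS).
  by apply/negP; rewrite -leNgt -Ic; apply: I_mono.
have conv c : 4 ^+ J0 <= c -> (I c < +oo)%E ->
    {ae (@lebesgue_measure R), forall x, x \in `]0, 1] ->
      (fun n => g (cf_prime_digit n x)%:R / cf_partial_sum n x) @ \oo --> (0 : R)}.
  move=> Jc Ic; apply: ae_prime_ratio_cvg0; last exact: fin Jc Ic.
  by move=> k; have := g3 _ (ler0n R (prime_part k)); lra.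
exists (4 ^+ J0); split; first by rewrite exprn_egt1 ?ltr1n//; lia.
move=> c Jc; split; last exact: conv.
split; last first.
  move=> Ic; apply: ae_prime_ratio_limsup; first by move=> k; exact: g3.
  exact: inf Ic.
(* A finite integral would force the limit 0 almost everywhere, against an infinite upper limit on a
   set of positive measure. *)
move=> ae_sup; apply/eqP; rewrite -leye_eq leNgt; apply/negP => Ic.
apply: (ae_unit_inconsistent ae_sup (conv c Jc Ic)) => x.
by move=> sup_oo /limn_esup_EFin_cvg0; rewrite sup_oo.
Qed.
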